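(* Let $F=T^2$ be the torus and let $\mathcal F$ be the space of all curves on $T^2$ (smooth immersions of the oriented circle $S^1$ into $T^2$). Let $\xi$ be a curve on $T^2$. Then $\pi_1(\mathcal F,\xi)$ is isomorphic to $\mathbb Z\oplus\mathbb Z\oplus\mathbb Z$.
   Context: A curve on a surface $F$ is a smooth immersion of an oriented circle $S^1$ into $F$. $\mathcal F$ denotes the space of all curves on $F$, with the $C^\infty$ topology. *)

(* Defs.v *)
From HB Require Import structures.
From mathcomp Require Import all_boot all_order all_algebra generic_quotient.
From mathcomp Require Import all_classical all_reals all_analysis.
From mathcomp Require Import homotopy.
From mathcomp Require Import lra.
Import Order.TTheory GRing.Theory Num.Theory.
Import numFieldNormedType.Exports.

Set Implicit Arguments.
Unset Strict Implicit.
Unset Printing Implicit Defensive.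

Local Open Scope classical_set_scope.
Local Open Scope ring_scope.
Local Open Scope quotient_scope.

Definition unit_itv (R : realType) : Type := set_type `[0 : R, 1].

HB.instance Definition _ (R : realType) := Topological.on (unit_itv R).

Section unit_itv.
Context {R : realType}.
Implicit Types (x : R) (t : unit_itv R).

Lemma clamp_subproof x : Num.max 0 (Num.min 1 x) \in `[0 : R, 1]%classic.
Proof.
by rewrite inE /= in_itv /= le_max lexx /= ge_max ler01 ge_min lexx.
Qed.

(* The retraction of the line onto the unit interval: paths are evaluated at
   [clamp a] so that reparametrizations need no membership proofs. *)
Definition clamp x : unit_itv R :=
  exist (fun y => y \in `[0 : R, 1]%classic) _ (clamp_subproof x).

Definition itv_val t : R := sval t.

Lemma itv_val_ge0 t : 0 <= itv_val t.
Proof. by case: t => x /=; rewrite inE /= in_itv /= => /andP[]. Qed.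

Lemma itv_val_le1 t : itv_val t <= 1.
Proof. by case: t => x /=; rewrite inE /= in_itv /= => /andP[]. Qed.

Lemma itv_val_inj : injective itv_val.
Proof. by move=> s t st; exact: eq_sig_hprop. Qed.

Lemma itv_valK : cancel itv_val clamp.
Proof.
move=> t; apply: itv_val_inj => /=.
by rewrite /itv_val/= min_r ?itv_val_le1 // max_r // itv_val_ge0.
Qed.

Lemma clampK x : 0 <= x <= 1 -> itv_val (clamp x) = x.
Proof. by move=> /andP[x0 x1]; rewrite /itv_val/= min_r // max_r. Qed.

Lemma clamp_le0 x : x <= 0 -> clamp x = clamp 0.
Proof.
move=> x0; apply: itv_val_inj; rewrite /itv_val/=.
by rewrite !min_r ?ler01 ?(le_trans x0) // !max_l.
Qed.

Lemma clamp_ge1 x : 1 <= x -> clamp x = clamp 1.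
Proof. by move=> x1; apply: itv_val_inj; rewrite /itv_val/= !min_l. Qed.

Lemma clamp_continuous : continuous clamp.
Proof.
apply: continuous_comp_initial => x.
apply: (@continuous_max _ _ (cst 0 : R -> R^o) ((cst 1 : R -> R^o) \min id) x).
  exact: cvg_cst.
by apply: (@continuous_min _ _ (cst 1 : R -> R^o) id x);
  [exact: cvg_cst|exact: cvg_id].
Qed.

Lemma itv_val_continuous : continuous itv_val.
Proof. exact: initial_continuous. Qed.

Lemma clamp01_neq : clamp 0 != clamp 1.
Proof.
apply/eqP => /(congr1 itv_val).
by rewrite !clampK ?lexx ?ler01 // => /esym/eqP; rewrite oner_eq0.
Qed.

HB.instance Definition _ := isBiPointed.Build (unit_itv R) clamp01_neq.

End unit_itv.
Arguments clamp : simpl never.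
Arguments itv_val : simpl never.

Lemma continuous_paste (R : realType) (T U : topologicalType) (h : T -> R)
    (c : R) (f g : T -> U) :
  continuous h -> continuous f -> continuous g ->
  (forall t, h t = c -> f t = g t) ->
  continuous (fun t => if h t <= c then f t else g t).
Proof.
move=> ch cf cg fg; apply/continuous_subspace_setT.
have -> : setT = [set t | h t <= c] `|` [set t | c <= h t].
  by apply/seteqP; split => // t _ /=; have [?|/ltW ?] := leP (h t) c; [left|right].
apply: withinU_continuous.
- exact: (closed_comp (fun t _ => ch t) (@closed_le R c)).
- exact: (closed_comp (fun t _ => ch t) (@closed_ge R c)).
- apply: (@subspace_eq_continuous _ _ _ f); last exact: continuous_subspaceT.
  by move=> t; rewrite inE /= /from_subspace => ->.
- apply: (@subspace_eq_continuous _ _ _ g); last exact: continuous_subspaceT.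
  move=> t; rewrite inE /= /from_subspace => ct; case: ifPn => // tc.
  by apply/esym/fg/le_anti; rewrite tc ct.
Qed.

Section loops.
Context {R : realType} {X : topologicalType} (x : X).
Let I := unit_itv R.
Let loop := {path I from x to x in X}.

Definition homotopic (p q : loop) : Prop :=
  exists H : I * I -> X, [/\ continuous H,
    forall t, H (zero, t) = p t,
    forall t, H (one, t) = q t,
    forall s, H (s, zero) = x &
    forall s, H (s, one) = x].

Lemma itv_zeroE : (zero : I) = clamp 0. Proof. by []. Qed.
Lemma itv_oneE : (one : I) = clamp 1. Proof. by []. Qed.

Lemma itv_val_zero : itv_val (zero : I) = 0.
Proof. by rewrite clampK// lexx ler01. Qed.

Lemma itv_val_one : itv_val (one : I) = 1.
Proof. by rewrite clampK// lexx ler01. Qed.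

Lemma continuous_clamp_comp (T : topologicalType) (f : T -> R) :
  continuous f -> continuous (fun t => clamp (f t)).
Proof.
by move=> cf t; apply: (continuous_comp (f := f)); [exact: cf|exact: clamp_continuous].
Qed.

Lemma continuous_path_clamp (T : topologicalType) (p : loop) (f : T -> R) :
  continuous f -> continuous (fun t => p (clamp (f t))).
Proof.
move=> cf t; apply: (continuous_comp (f := fun t => clamp (f t))).
  exact: continuous_clamp_comp.
exact: cts_fun.
Qed.

Lemma continuous_affine (T : topologicalType) (f : T -> R) (a b : R) :
  continuous f -> continuous (fun t => a * f t + b).
Proof.
move=> cf t; apply: (@continuousD R R^o T (fun t => a * f t) (cst b)).
  by apply: (@continuousM R T (cst a) f); [exact: cvg_cst|exact: cf].
exact: cvg_cst.
Qed.

Lemma continuous_double (T : topologicalType) (f : T -> R) :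
  continuous f -> continuous (fun t => 2 * f t).
Proof.
by move=> cf t; apply: (@continuousM R T (cst 2) f); [exact: cvg_cst|exact: cf].
Qed.

Lemma continuous_compl (T : topologicalType) (f : T -> R) :
  continuous f -> continuous (fun t => 1 - f t).
Proof.
move=> cf t; apply: (@continuousB R R^o T (cst 1) f); last exact: cf.
exact: cvg_cst.
Qed.

Lemma loop_le0 (p : loop) a : a <= 0 -> p (clamp a) = x.
Proof. by move=> /clamp_le0 ->; rewrite -itv_zeroE path_zero. Qed.

Lemma loop_ge1 (p : loop) a : 1 <= a -> p (clamp a) = x.
Proof. by move=> /clamp_ge1 ->; rewrite -itv_oneE path_one. Qed.

Definition concat_fun (p q : loop) (t : I) : X :=
  if itv_val t <= 2^-1 then p (clamp (2 * itv_val t))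
  else q (clamp (2 * itv_val t - 1)).

Lemma concat_funE (p q : loop) a : concat_fun p q (clamp a) =
  if a <= 2^-1 then p (clamp (2 * a)) else q (clamp (2 * a - 1)).
Proof.
rewrite /concat_fun; have [a0|a0] := ltP a 0.
  rewrite clamp_le0 ?(ltW a0)// clampK ?lexx ?ler01//.
  rewrite !ifT; [|lra|lra].
  by rewrite !loop_le0//; lra.
have [a1|a1] := ltP 1 a; last by rewrite clampK ?a0.
rewrite clamp_ge1 ?(ltW a1)// clampK ?lexx ?ler01//.
rewrite !ifF; [|lra|lra].
by rewrite !loop_ge1//; lra.
Qed.

Lemma concat_fun_continuous p q : continuous (concat_fun p q).
Proof.
apply: continuous_paste.
- exact: itv_val_continuous.
- exact/continuous_path_clamp/continuous_double/itv_val_continuous.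
- exact/continuous_path_clamp/continuous_affine/itv_val_continuous.
- by move=> t ->; rewrite loop_ge1 ?loop_le0//; lra.
Qed.

Lemma concat_fun_zero p q : concat_fun p q zero = x.
Proof. by rewrite itv_zeroE concat_funE ifT ?loop_le0//; lra. Qed.

Lemma concat_fun_one p q : concat_fun p q one = x.
Proof. by rewrite itv_oneE concat_funE ifF ?loop_ge1//; lra. Qed.

Definition loop_concat p q : loop :=
  mk_path (@concat_fun_continuous p q) (concat_fun_zero p q)
    (concat_fun_one p q).

Definition reverse_fun (p : loop) (t : I) : X := p (clamp (1 - itv_val t)).

Lemma reverse_funE p a : reverse_fun p (clamp a) = p (clamp (1 - a)).
Proof.
rewrite /reverse_fun; have [a0|a0] := ltP a 0.
  rewrite [clamp a]clamp_le0 ?(ltW a0)// clampK ?lexx ?ler01//.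
  by rewrite !loop_ge1//; lra.
have [a1|a1] := ltP 1 a; last by rewrite clampK ?a0.
rewrite [clamp a]clamp_ge1 ?(ltW a1)// clampK ?lexx ?ler01//.
by rewrite !loop_le0//; lra.
Qed.

Lemma reverse_fun_continuous p : continuous (reverse_fun p).
Proof.
exact/continuous_path_clamp/continuous_compl/itv_val_continuous.
Qed.

Lemma reverse_fun_zero p : reverse_fun p zero = x.
Proof. by rewrite itv_zeroE reverse_funE loop_ge1//; lra. Qed.

Lemma reverse_fun_one p : reverse_fun p one = x.
Proof. by rewrite itv_oneE reverse_funE loop_le0//; lra. Qed.

Definition loop_reverse p : loop :=
  mk_path (@reverse_fun_continuous p) (reverse_fun_zero p) (reverse_fun_one p).

Definition constant_loop : loop := @cst I X x.

Lemma fst_val_continuous : continuous (fun st : I * I => itv_val st.1).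
Proof.
move=> st; apply: (continuous_comp (f := fst)); first exact: cvg_fst.
exact: itv_val_continuous.
Qed.

Lemma snd_val_continuous : continuous (fun st : I * I => itv_val st.2).
Proof.
move=> st; apply: (continuous_comp (f := snd)); first exact: cvg_snd.
exact: itv_val_continuous.
Qed.

Lemma homotopic_reparam (r p q : loop) (f g : R -> R) :
  continuous f -> continuous g ->
  (forall a, p (clamp a) = r (clamp (f a))) ->
  (forall a, q (clamp a) = r (clamp (g a))) ->
  (forall a b, a = 0 \/ a = 1 -> 0 <= b <= 1 ->
    r (clamp (f a + b * (g a - f a))) = x) ->
  homotopic p q.
Proof.
move=> cf cg pf qg e.
exists (fun st => r (clamp (f (itv_val st.2) +
  itv_val st.1 * (g (itv_val st.2) - f (itv_val st.2))))); split => /=.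
- have cc (h : R -> R) : continuous h ->
      continuous (fun st : I * I => h (itv_val st.2)).
    move=> ch st.
    apply: (continuous_comp (f := fun st : I * I => itv_val st.2) (g := h)).
      exact: snd_val_continuous.
    exact: ch.
  apply: continuous_path_clamp => st.
  apply: (@continuousD R R^o _ (fun st : I * I => f (itv_val st.2))
    (fun st => itv_val st.1 * (g (itv_val st.2) - f (itv_val st.2)))).
    exact: cc cf st.
  apply: (@continuousM R _ (fun st : I * I => itv_val st.1)
    (fun st => g (itv_val st.2) - f (itv_val st.2))).
    exact: fst_val_continuous.
  apply: (@continuousB R R^o _ (fun st : I * I => g (itv_val st.2))
    (fun st => f (itv_val st.2))).
    exact: cc cg st.
  exact: cc cf st.
- by move=> t; rewrite itv_val_zero mul0r addr0 -pf itv_valK.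
- by move=> t; rewrite itv_val_one mul1r subrKC -qg itv_valK.
- by move=> s; rewrite itv_val_zero e ?itv_val_ge0 ?itv_val_le1//; left.
- by move=> s; rewrite itv_val_one e ?itv_val_ge0 ?itv_val_le1//; right.
Qed.

Lemma homotopic_refl p : homotopic p p.
Proof.
apply: (@homotopic_reparam p p p id id) => //; try by move=> ?; exact: cvg_id.
by move=> a b [->|->] _; [rewrite loop_le0//|rewrite loop_ge1//]; lra.
Qed.

Lemma continuous_pair_comp (T : topologicalType) (H : I * I -> X)
    (f g : T -> I) :
  continuous H -> continuous f -> continuous g ->
  continuous (fun t => H (f t, g t)).
Proof.
move=> cH cf cg t; apply: (continuous_comp (f := fun t => (f t, g t)) (g := H)).
  exact: (cvg_pair (cf t) (cg t)).
exact: cH.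
Qed.

Lemma homotopic_sym p q : homotopic p q -> homotopic q p.
Proof.
move=> [H [cH H0 H1 Hz Ho]].
exists (fun st => H (clamp (1 - itv_val st.1), st.2)); split => //=.
- apply: (@continuous_pair_comp _ H (fun st => clamp (1 - itv_val st.1)) snd).
  + exact: cH.
  + exact/continuous_clamp_comp/continuous_compl/fst_val_continuous.
  + by move=> st; exact: cvg_snd.
- by move=> t; rewrite itv_val_zero subr0 -itv_oneE H1.
- by move=> t; rewrite itv_val_one subrr -itv_zeroE H0.
Qed.

Lemma continuous_rescale (H : I * I -> X) (f g : I * I -> R) :
  continuous H -> continuous f -> continuous g ->
  continuous (fun st => H (clamp (f st), clamp (g st))).
Proof.
by move=> cH cf cg; apply: continuous_pair_comp => //; exact: continuous_clamp_comp.
Qed.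

Lemma homotopic_trans p q r :
  homotopic p q -> homotopic q r -> homotopic p r.
Proof.
move=> [H [cH H0 H1 Hz Ho]] [K [cK K0 K1 Kz Ko]].
exists (fun st => if itv_val st.1 <= 2^-1
  then H (clamp (2 * itv_val st.1), clamp (itv_val st.2))
  else K (clamp (2 * itv_val st.1 - 1), clamp (itv_val st.2))); split => /=.
- apply: continuous_paste; first exact: fst_val_continuous.
  + apply: continuous_rescale => //; last exact: snd_val_continuous.
    exact/continuous_double/fst_val_continuous.
  + apply: continuous_rescale => //; last exact: snd_val_continuous.
    exact/continuous_affine/fst_val_continuous.
  + by move=> t ->; rewrite divff// subrr itv_valK -itv_oneE -itv_zeroE H1 K0.
- by move=> t; rewrite itv_val_zero mulr0 itv_valK ifT -?itv_zeroE ?H0//; lra.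
- move=> t; rewrite itv_val_one itv_valK ifF; last lra.
  by rewrite clamp_ge1 -?itv_oneE ?K1//; lra.
- by move=> s; rewrite itv_valK; case: ifPn.
- by move=> s; rewrite itv_valK; case: ifPn.
Qed.

Lemma homotopic_concat p p' q q' :
  homotopic p p' -> homotopic q q' -> homotopic (loop_concat p q) (loop_concat p' q').
Proof.
move=> [H [cH H0 H1 Hz Ho]] [K [cK K0 K1 Kz Ko]].
exists (fun st => if itv_val st.2 <= 2^-1
  then H (clamp (itv_val st.1), clamp (2 * itv_val st.2))
  else K (clamp (itv_val st.1), clamp (2 * itv_val st.2 - 1))); split => /=.
- apply: continuous_paste; first exact: snd_val_continuous.
  + apply: continuous_rescale => //; first exact: fst_val_continuous.
    exact/continuous_double/snd_val_continuous.
  + apply: continuous_rescale => //; first exact: fst_val_continuous.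
    exact/continuous_affine/snd_val_continuous.
  + by move=> t ->; rewrite divff// subrr -itv_oneE -itv_zeroE Ho Kz.
- by move=> t; rewrite itv_valK H0 K0.
- by move=> t; rewrite itv_valK H1 K1.
- by move=> s; rewrite itv_val_zero mulr0 ifT -?itv_zeroE ?Hz//; lra.
- move=> s; rewrite itv_val_one ifF; last lra.
  by rewrite [clamp (_ - _)]clamp_ge1 -?itv_oneE ?Ko//; lra.
Qed.

Lemma homotopic_reverse p q : homotopic p q -> homotopic (loop_reverse p) (loop_reverse q).
Proof.
move=> [H [cH H0 H1 Hz Ho]].
exists (fun st => H (clamp (itv_val st.1), clamp (1 - itv_val st.2))).
split => /=.
- apply: continuous_rescale => //; first exact: fst_val_continuous.
  exact/continuous_compl/snd_val_continuous.
- by move=> t; rewrite itv_valK H0.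
- by move=> t; rewrite itv_valK H1.
- by move=> s; rewrite itv_val_zero subr0 -itv_oneE Ho.
- by move=> s; rewrite itv_val_one subrr -itv_zeroE Hz.
Qed.

Lemma affine_continuous (a b : R) : continuous (fun y : R => a * y + b).
Proof. by apply: continuous_affine => ?; exact: cvg_id. Qed.

Lemma homotopic_concat1l p : homotopic (loop_concat constant_loop p) p.
Proof.
apply: (@homotopic_reparam p _ _ (fun a => 2 * a - 1) id) => //.
- exact: affine_continuous.
- by move=> ?; exact: cvg_id.
- move=> a; rewrite /= [LHS]concat_funE; case: ifPn => // a1.
  by rewrite [RHS]loop_le0//; lra.
- by move=> a b [->|->] /andP[b0 b1]; [rewrite loop_le0//|rewrite loop_ge1//]; lra.
Qed.

Lemma homotopic_concat1r p : homotopic (loop_concat p constant_loop) p.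
Proof.
apply: (@homotopic_reparam p _ _ (fun a => 2 * a + 0) id) => //.
- exact: affine_continuous.
- by move=> ?; exact: cvg_id.
- move=> a; rewrite /= [LHS]concat_funE addr0; case: ifPn => // a1.
  by rewrite [RHS]loop_ge1//; lra.
- by move=> a b [->|->] /andP[b0 b1]; [rewrite loop_le0//|rewrite loop_ge1//]; lra.
Qed.

Lemma homotopic_concatV p : homotopic (loop_concat p (loop_reverse p)) constant_loop.
Proof.
apply: (@homotopic_reparam p _ _
  (fun a => if a <= 2^-1 then 2 * a + 0 else - 2 * a + 2) (cst 0)).
- apply: (@continuous_paste R R R id); [|exact: affine_continuous..|].
    by move=> ?; exact: cvg_id.
  by move=> a ->; lra.
- by move=> ?; exact: cvg_cst.
- move=> a; rewrite /= [LHS]concat_funE; case: ifPn => // a1.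
    by rewrite addr0.
  by rewrite [LHS]reverse_funE; congr (p (clamp _)); lra.
- by move=> a; rewrite [RHS]loop_le0.
- move=> a b [->|->] /andP[b0 b1] /=.
    have -> : (0 : R) <= 2^-1 by lra.
    by rewrite loop_le0//; lra.
  have /negbTE -> : ~~ ((1 : R) <= 2^-1) by lra.
  by rewrite loop_le0//; lra.
Qed.

Lemma homotopic_concatVl p : homotopic (loop_concat (loop_reverse p) p) constant_loop.
Proof.
apply: (@homotopic_reparam p _ _
  (fun a => if a <= 2^-1 then - 2 * a + 1 else 2 * a - 1) (cst 1)).
- apply: (@continuous_paste R R R id); [|exact: affine_continuous..|].
    by move=> ?; exact: cvg_id.
  by move=> a ->; lra.
- by move=> ?; exact: cvg_cst.
- move=> a; rewrite /= [LHS]concat_funE; case: ifPn => // a1.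
  by rewrite [LHS]reverse_funE; congr (p (clamp _)); lra.
- by move=> a; rewrite [RHS]loop_ge1.
- move=> a b [->|->] /andP[b0 b1] /=.
    have -> : (0 : R) <= 2^-1 by lra.
    by rewrite loop_ge1//; lra.
  have /negbTE -> : ~~ ((1 : R) <= 2^-1) by lra.
  by rewrite loop_ge1//; lra.
Qed.

Lemma homotopic_concatA p q r :
  homotopic (loop_concat p (loop_concat q r)) (loop_concat (loop_concat p q) r).
Proof.
apply: (@homotopic_reparam (loop_concat (loop_concat p q) r) _ _
  (fun a => if a <= 2^-1 then 2^-1 * a + 0 else
     if a <= 3 / 4 then 1 * a - 4^-1 else 2 * a - 1) id) => //.
- apply: (@continuous_paste R R R id).
  + by move=> ?; exact: cvg_id.
  + exact: affine_continuous.
  + apply: (@continuous_paste R R R id); [|exact: affine_continuous..|].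
      by move=> ?; exact: cvg_id.
    by move=> a ->; lra.
  + by move=> a ->; rewrite ifT; lra.
- by move=> ?; exact: cvg_id.
- move=> a /=; rewrite [LHS]concat_funE [RHS]concat_funE.
  case: ifPn => a1.
    rewrite ifT; last lra.
    rewrite [RHS]concat_funE ifT; last lra.
    by congr (p (clamp _)); lra.
  rewrite [LHS]concat_funE; case: ifPn => a2.
    have a3 : a <= 3 / 4 by lra.
    rewrite a3 ifT; last lra.
    rewrite [RHS]concat_funE ifF; last lra.
    by congr (q (clamp _)); lra.
  have /negbTE a3 : ~~ (a <= 3 / 4) by lra.
  rewrite a3 ifF; last lra.
  by congr (r (clamp _)); lra.
- move=> a b [->|->] /andP[b0 b1] /=.
    have -> : (0 : R) <= 2^-1 by lra.
    by rewrite loop_le0//; lra.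
  have /negbTE -> : ~~ ((1 : R) <= 2^-1) by lra.
  have /negbTE -> : ~~ ((1 : R) <= 3 / 4) by lra.
  by rewrite loop_ge1//; lra.
Qed.

End loops.


Section fundamental_group.
Context (R : realType) (X : topologicalType) (x : X).
Let I := unit_itv R.
Let loop := {path I from x to x in X}.

Let homotopicb (p q : loop) := `[< homotopic p q >].

Lemma homotopicb_refl : reflexive homotopicb.
Proof. by move=> p; apply/asboolP/homotopic_refl. Qed.

Lemma homotopicb_sym : symmetric homotopicb.
Proof. by move=> p q; apply/asboolP/asboolP => /homotopic_sym. Qed.

Lemma homotopicb_trans : transitive homotopicb.
Proof.
move=> q p r /asboolP pq /asboolP qr; apply/asboolP; exact: homotopic_trans qr.
Qed.

Definition homotopy_rel :=
  EquivRel homotopicb homotopicb_refl homotopicb_sym homotopicb_trans.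

Definition fundamental_group := {eq_quot homotopy_rel}.

HB.instance Definition _ := Choice.on fundamental_group.
HB.instance Definition _ := Quotient.on fundamental_group.

Definition loop_class (p : loop) : fundamental_group := \pi p.

Definition pi1_one := loop_class (constant_loop x).

Definition pi1_mul (a b : fundamental_group) : fundamental_group :=
  loop_class (loop_concat (repr a) (repr b)).

Definition pi1_inv (a : fundamental_group) : fundamental_group :=
  loop_class (loop_reverse (repr a)).

Lemma loop_classP p q : loop_class p = loop_class q <-> homotopic p q.
Proof. by split=> [/eqmodP/asboolP|pq]; last exact/eqmodP/asboolP. Qed.

Lemma loop_classK (a : fundamental_group) : loop_class (repr a) = a.
Proof. exact: reprK. Qed.

Lemma repr_loop_class p : homotopic (repr (loop_class p)) p.
Proof. by apply/loop_classP; rewrite loop_classK. Qed.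

Lemma pi1_mulE p q :
  pi1_mul (loop_class p) (loop_class q) = loop_class (loop_concat p q).
Proof. by apply/loop_classP/homotopic_concat; exact: repr_loop_class. Qed.

Lemma pi1_invE p : pi1_inv (loop_class p) = loop_class (loop_reverse p).
Proof. by apply/loop_classP/homotopic_reverse; exact: repr_loop_class. Qed.

Lemma pi1_mulA : associative pi1_mul.
Proof.
move=> a b c; rewrite -[a]loop_classK -[b]loop_classK -[c]loop_classK !pi1_mulE.
exact/loop_classP/homotopic_concatA.
Qed.

Lemma pi1_mul1g : left_id pi1_one pi1_mul.
Proof.
move=> a; rewrite -[a]loop_classK pi1_mulE.
exact/loop_classP/homotopic_concat1l.
Qed.

Lemma pi1_mulg1 : right_id pi1_one pi1_mul.
Proof.
move=> a; rewrite -[a]loop_classK pi1_mulE.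
exact/loop_classP/homotopic_concat1r.
Qed.

Lemma pi1_mulVg : left_inverse pi1_one pi1_inv pi1_mul.
Proof.
move=> a; rewrite -[a]loop_classK pi1_invE pi1_mulE.
exact/loop_classP/homotopic_concatVl.
Qed.

Lemma pi1_mulgV : right_inverse pi1_one pi1_inv pi1_mul.
Proof.
move=> a; rewrite -[a]loop_classK pi1_invE pi1_mulE.
exact/loop_classP/homotopic_concatV.
Qed.

HB.instance Definition _ := isGroup.Build fundamental_group
  pi1_mulA pi1_mul1g pi1_mulg1 pi1_mulVg pi1_mulgV.

End fundamental_group.

Definition group_isomorphic (G H : groupType) : Prop :=
  exists f : {multiplicative G -> H}, bijective f.

Section torus_curves.
Context (R : realType).

Definition circle : Type := set_type [set z : R * R | z.1 ^+ 2 + z.2 ^+ 2 = 1].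

Definition torus : Type := (circle * circle)%type.

Definition torus_val (p : torus) : (R * R) * (R * R) := (sval p.1, sval p.2).

Lemma circle_point_subproof (t : R) :
  (cos t, sin t) \in [set z : R * R | z.1 ^+ 2 + z.2 ^+ 2 = 1].
Proof. by rewrite inE /= cos2Dsin2. Qed.

Definition circle_point (t : R) : circle :=
  exist (fun z => z \in [set z : R * R | z.1 ^+ 2 + z.2 ^+ 2 = 1]) _
    (circle_point_subproof t).

(* The torus is a submanifold of (R^2)^2 and [circle_point] is a covering map
   that is a local diffeomorphism, orienting the circle counterclockwise: the
   differentiability class of [f], the injectivity of its differential and its
   derivatives of all orders are therefore read off the periodic function
   [angular f]. *)
Definition angular (f : circle -> torus) (t : R) : (R * R) * (R * R) :=
  torus_val (f (circle_point t)).

Definition smooth (f : circle -> torus) : Prop :=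
  forall (n : nat) (t : R), derivable (derive1n n (angular f)) t 1.

Definition smooth_immersion (f : circle -> torus) : Prop :=
  smooth f /\ forall t : R, derive1 (angular f) t != 0.

Definition torus_curve : Type := {f : circle -> torus | smooth_immersion f}.

Definition derivatives (xi : torus_curve) :
    prod_topology (fun _ : nat => {uniform R -> (R * R) * (R * R)}) :=
  fun n => derive1n n (angular (sval xi)).

HB.instance Definition _ := gen_eqMixin torus_curve.
HB.instance Definition _ := gen_choiceMixin torus_curve.

(* The C^oo topology: the coarsest one for which every derivative, the zeroth
   included, depends continuously on the curve for uniform convergence. *)
HB.instance Definition _ :=
  Topological.copy torus_curve (initial_topology derivatives).

End torus_curves.

(* Main.v *)
(* The torus is a group, so a path of curves starting at xi has the form
   xi * exp(i e_s) with e_s : R -> R^2 smooth and 2pi-periodic, of velocity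
   v_s = v_0 + e_s', and v_s is a positive multiple of exp(i D_s) v_0.  For a
   loop, e_1 and D_1 are constants in (2pi Z)^2 and 2pi Z, and these three
   integers define the isomorphism.  Both its injectivity and its surjectivity
   come from a one-parameter h-principle.  Identify R^2 with C and let
     f(x) = cos 2x + i sin x,   g(x) = (sin 2x) / 2 - i cos x,   g' = f.
   Adding (1/N) B(t) g(N t) to e adds B(t) f(N t) to the velocity, up to an
   error (1/N) B'(t) g(N t) that vanishes uniformly as N grows, and keeps the
   curve closed without any integral condition.  The loop f avoids 0 and the
   negative half-line, hence v + c v f never vanishes for c >= 0: one can thus
   switch on a perturbation B = M P that dominates the velocity (P = v, M
   large), and then deform the slow part e and the nonvanishing field P
   independently.  The field P is deformed to v_0 by unwinding its angle D_s
   (injectivity), or turned k times (surjectivity). *)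
From HB Require Import structures.
Require Import Defs.
From mathcomp Require Import all_boot all_order all_algebra.
From mathcomp Require Import all_classical all_reals all_analysis.
From mathcomp Require Import homotopy ring lra zify.
Import Order.TTheory GRing.Theory Num.Theory.
Import numFieldNormedType.Exports.

Set Implicit Arguments.
Unset Strict Implicit.
Unset Printing Implicit Defensive.

Local Open Scope classical_set_scope.
Local Open Scope ring_scope.

(** * Topology of the space of curves *)

(** Two constraints pull against each other: the velocity must never vanish and the curve must stay
    closed. Contracting e linearly to 0 keeps the curve closed but may make the velocity vanish;
    unwinding the angle of the velocity keeps it nonzero but may open the curve. A dominating
    perturbation decouples them: its field only has to be nonvanishing and periodic, the slow part e
    only periodic. The order of the choices matters. M comes from bounds on the slow velocity and on
    the field over the whole compact parameter space; N comes last, against a lower bound that does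
    not involve N. Since f(0) = 1, the fast term at t = 0 is a nonnegative multiple of the field
    itself, so the turning of the velocity at t = 0 can be compared with that of the field. The
    three integers are read at t = 0 only: the final value of a lift is a continuous function of t
    with values in 2pi Z, hence the same for all t. They are winding numbers of three nowhere zero
    continuous maps from the space of curves to the plane, which makes them homotopy invariant and
    additive. *)

Lemma continuous_at_pair (T U W : topologicalType) (f : T -> U) (g : T -> W) x :
  {for x, continuous f} -> {for x, continuous g} ->
  {for x, continuous (fun t => (f t, g t))}.
Proof. by move=> cf cg; exact: (cvg_pair cf cg). Qed.

Lemma continuous_fst (T U : topologicalType) : continuous (@fst T U).
Proof. by move=> x; exact: cvg_fst. Qed.

Lemma continuous_snd (T U : topologicalType) : continuous (@snd T U).
Proof. by move=> x; exact: cvg_snd. Qed.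

Lemma continuousT_comp (T U W : topologicalType) (f : T -> U) (g : U -> W) :
  continuous f -> continuous g -> continuous (fun t => g (f t)).
Proof. by move=> cf cg t; apply: (continuous_comp (cf t)); exact: cg. Qed.

Lemma continuousT_pair (T U W : topologicalType) (f : T -> U) (g : T -> W) :
  continuous f -> continuous g -> continuous (fun t => (f t, g t)).
Proof. by move=> cf cg t; exact: (continuous_at_pair (cf t) (cg t)). Qed.

(** The tube lemma, read off the near-covering form of compactness. *)
Lemma compact_tube (K T : topologicalType) (A : set T) (P : K -> T -> Prop) (k0 : K) :
  compact A -> (forall t, A t -> nbhs (k0, t) [set kt | P kt.1 kt.2]) ->
  \forall k \near k0, forall t, A t -> P k t.
Proof.
move=> cA h.
move/compact_near_coveringP: cA => /(_ K (nbhs k0) P); apply => t At.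
have [[U V] /= [Uk Vt] UV] := h t At; exists (V, U) => //= -[x y] /= [? ?].
exact: (UV (y, x)).
Qed.

Section curves_topology.
Context {R : realType}.
Local Notation V := ((R * R) * (R * R))%type.

Lemma derive1_periodic (W : normedModType R) (f : R -> W) (T : R) :
  (forall t, f (t + T) = f t) -> forall t, derive1 f (t + T) = derive1 f t.
Proof.
move=> fT t; rewrite /derive1.
by under eq_fun do rewrite addrA fT fT.
Qed.

Lemma derive1n_periodic (W : normedModType R) (f : R -> W) (T : R) n :
  (forall t, f (t + T) = f t) ->
  forall t, derive1n n f (t + T) = derive1n n f t.
Proof.
move=> fT; elim: n => [//|n IHn] t.
by rewrite derive1nS; apply: derive1_periodic.
Qed.

Lemma angular_periodic (f : circle R -> torus R) t :
  angular f (t + pi *+ 2) = angular f t.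
Proof.
rewrite /angular; congr (torus_val (f _)); apply: eq_sig_hprop => //=.
by rewrite cosD2pi sinD2pi.
Qed.

Lemma pi2_gt0 : 0 < pi *+ 2 :> R.
Proof. by rewrite pmulrn_lgt0 ?pi_gt0. Qed.

Lemma periodic_int (W : Type) (f : R -> W) (T : R) :
  (forall t, f (t + T) = f t) -> forall t (z : int), f (t + T * z%:~R) = f t.
Proof.
move=> fT t z.
have fn (n : nat) u : f (u + T * n%:R) = f u.
  elim: n => [|n IHn]; first by rewrite mulr0 addr0.
  by rewrite -natr1 mulrDr mulr1 addrA fT.
case: z => n; first exact: fn.
by rewrite -[in RHS](subrK (T * n.+1%:R) t) fn NegzE mulrNz mulrN.
Qed.

Lemma angle_reduce (t : R) :
  exists z : int, 0 <= t + (pi *+ 2) * z%:~R < pi *+ 2.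
Proof.
exists (- Num.floor (t / (pi *+ 2))).
have := floor_itv (t / (pi *+ 2)) => /andP[q1 q2].
rewrite mulrNz mulrN subr_ge0 ltrBlDr mulrC -ler_pdivlMr ?pi2_gt0// q1 /=.
rewrite -[X in X + _]mul1r -mulrDl addrC -ltr_pdivrMr ?pi2_gt0//.
by rewrite -(@intrD _ _ 1).
Qed.

Lemma periodic_reduce (W : Type) (f : R -> W) :
  (forall t, f (t + pi *+ 2) = f t) ->
  forall t, exists2 t', t' \in `[0, pi *+ 2] & f t' = f t.
Proof.
move=> fT t; have [z /andP[z1 z2]] := angle_reduce t.
exists (t + (pi *+ 2) * z%:~R); first by rewrite in_itv /= z1 ltW.
exact: periodic_int.
Qed.

(** The topology asks for uniform closeness of each derivative over the whole line. Periodicity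
    reduces this to the compact segment [0, 2pi], where the tube lemma turns joint continuity into
    uniform closeness. *)
Lemma torus_curve_continuous (K : topologicalType) (g : K -> torus_curve R) :
  (forall n, continuous (fun kt : K * R =>
     derive1n n (angular (sval (g kt.1))) kt.2 : V)) ->
  continuous g.
Proof.
move=> cg; apply: continuous_comp_initial => k0.
apply/cvg_sup => n; apply/cvg_image.
  by rewrite predeqE => f; split => // _; exists (fun=> f).
move=> W /uniform_nbhs[E [entE EW]].
exists (fun f => W (f n)); last first.
  by rewrite predeqE => f; split => [[h Wh <-//]|Wf]; exists (fun=> f).
pose G k t : V := derive1n n (angular (sval (g k))) t.
have GT k t : G k (t + pi *+ 2) = G k t.
  by apply: derive1n_periodic => u; exact: angular_periodic.
have tube := @compact_tube K R `[0, pi *+ 2] (fun k t => E (G k0 t, G k t)) k0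
  (@segment_compact R 0 (pi *+ 2)).
have G0 t : {for t, continuous (G k0)}.
  apply: (@continuous_comp R (K * R)%type V (fun t => (k0, t))
    (fun kt => G kt.1 kt.2) t); last exact: cg.
  exact: (continuous_at_pair (@cvg_cst _ k0 _ _ _) cvg_id).
apply: filterS (tube _) => [k h|].
  apply: EW => t _.
  have [t' t'I] := periodic_reduce
    (f := fun t => (G k0 t, G k t)) (fun t => f_equal2 pair (GT k0 t) (GT k t)) t.
  by move=> [e1 e2]; rewrite -[X in E (X, _)]e1 -[X in E (_, X)]e2; exact: h.
move=> t _.
(* The values of [G k0] and [G k] at a nearby time are compared through the value [G k0 t]. *)
pose E2 := split_ent E.
have entE2 : entourage E2 by exact: entourage_split_ent.
have h1 : nbhs (k0, t) [set kt : K * R | E2 (G k0 t, G kt.1 kt.2)].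
  by have /cvg_entourageP/(_ _ entE2) := cg n (k0, t).
have h2 : nbhs (k0, t) [set kt : K * R | E2 (G k0 kt.2, G k0 t)].
  have /cvg_entourageP/(_ _ (entourage_inv entE2)) := G0 t.
  exact: (@cvg_snd K R (nbhs k0) (nbhs t)).
apply: filterS2 h1 h2 => -[k u] /= h1 h2.
exact: (entourage_split (G k0 t) entE h2 h1).
Qed.


(** Converse of [torus_curve_continuous]: closeness is uniform in time and each derivative of the
    fixed curve [g k0] is continuous. Continuous families of curves can thus be handled as functions
    of a parameter and of time. *)
Lemma continuous_derivatives (K : topologicalType) (g : K -> torus_curve R) :
  continuous g -> forall n, continuous (fun kt : K * R =>
     derive1n n (angular (sval (g kt.1))) kt.2 : V).
Proof.
move=> cg n [k0 t0].
have c1 : {for k0, continuous (fun k => derive1n n (angular (sval (g k))) : {uniform R -> V})}.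
  have c2 : {for k0, continuous (fun k => derivatives (g k))}.
    apply: (@continuous_comp _ _ _ g (@derivatives R) k0); first exact: cg.
    exact: (@initial_continuous _ _ (@derivatives R)).
  apply: (@continuous_comp K (prod_topology (fun _ : nat => {uniform R -> V}))
    {uniform R -> V} (fun k => derivatives (g k)) (fun f => f n) k0 c2).
  exact: (@proj_continuous nat (fun=> {uniform R -> V}) n).
have c3 : {for t0, continuous (derive1n n (angular (sval (g k0))))}.
  have [sm _] := svalP (g k0).
  by apply/differentiable_continuous/derivable1_diffP.
apply/cvg_entourageP => E entE.
pose E2 := split_ent E.
have entE2 : entourage E2 by exact: entourage_split_ent.
have h1 : nbhs (k0, t0) [set kt : K * R | E2 (derive1n n (angular (sval (g k0))) t0,
    derive1n n (angular (sval (g k0))) kt.2)].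
  have /cvg_entourageP/(_ _ entE2) := c3.
  exact: (@cvg_snd K R (nbhs k0) (nbhs t0)).
have h2 : nbhs (k0, t0) [set kt : K * R | E2 (derive1n n (angular (sval (g k0))) kt.2,
    derive1n n (angular (sval (g kt.1))) kt.2)].
  have : \forall k \near k0, forall t, E2 (derive1n n (angular (sval (g k0))) t,
      derive1n n (angular (sval (g k))) t).
    have /(_ [set f | forall t, E2 (derive1n n (angular (sval (g k0))) t, f t)]) := c1.
    apply; apply/uniform_nbhs; exists E2; split => // h Eh t; exact: Eh.
  move=> h; apply: (filterS (P := [set kt : K * R | forall t,
      E2 (derive1n n (angular (sval (g k0))) t,
      derive1n n (angular (sval (g kt.1))) t)])); first by move=> [k u] /= /(_ u).
  exact: (@cvg_fst K R (nbhs k0) (nbhs t0) _ _ h).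
apply: filterS2 h1 h2 => -[k u] /= h1 h2.
exact: (entourage_split _ entE h1 h2).
Qed.

End curves_topology.

(** * Families of functions smooth in the last variable *)

Section derive_pair.
Context {R : realType} {U W : normedModType R}.

Lemma is_derive1_fst (f : R -> U * W) (t : R) df :
  is_derive t 1 f df -> is_derive t 1 (fun u => (f u).1) df.1.
Proof.
move=> [df1 <-].
have c : h^-1 *: ((f (h *: 1 + t)).1 - (f t).1) @[h --> 0^'] --> ('D_1 f t).1.
  exact: (cvg_comp _ _ df1 (@cvg_fst _ _ _ _ _)).
by apply: DeriveDef; [apply/cvg_ex; exists ('D_1 f t).1|apply: cvg_lim].
Qed.

Lemma is_derive1_snd (f : R -> U * W) (t : R) df :
  is_derive t 1 f df -> is_derive t 1 (fun u => (f u).2) df.2.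
Proof.
move=> [df1 <-].
have c : h^-1 *: ((f (h *: 1 + t)).2 - (f t).2) @[h --> 0^'] --> ('D_1 f t).2.
  exact: (cvg_comp _ _ df1 (@cvg_snd _ _ _ _ _)).
by apply: DeriveDef; [apply/cvg_ex; exists ('D_1 f t).2|apply: cvg_lim].
Qed.

Lemma is_derive1_pair (f : R -> U) (g : R -> W) (t : R) df dg :
  is_derive t 1 f df -> is_derive t 1 g dg ->
  is_derive t 1 (fun u => (f u, g u)) (df, dg).
Proof.
move=> [df1 <-] [dg1 <-].
have c : h^-1 *: ((f (h *: 1 + t), g (h *: 1 + t)) - (f t, g t)) @[h --> 0^'] -->
    ('D_1 f t, 'D_1 g t).
  exact: (cvg_pair df1 dg1).
by apply: DeriveDef; [apply/cvg_ex; exists ('D_1 f t, 'D_1 g t)|apply: cvg_lim].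
Qed.

End derive_pair.

Section smooth_family.
Context {R : realType}.

(** Smoothness concerns time alone, but every time derivative is jointly continuous with the
    parameter: this is what continuity of a family of curves amounts to. The recursion on the order
    lets closure properties be proved by induction from the first derivative. *)
Fixpoint smooth_upto (K : topologicalType) (n : nat) (f : K -> R -> R) : Prop :=
  continuous (fun kt : K * R => f kt.1 kt.2) /\
  if n is m.+1 then (forall k t, derivable (f k) t 1) /\
    smooth_upto m (fun k => derive1 (f k)) else True.

Definition smooth_family (K : topologicalType) (f : K -> R -> R) : Prop :=
  forall n, smooth_upto n f.

Context {K : topologicalType}.
Implicit Types f g : K -> R -> R.

Lemma smooth_upto_cont n f : smooth_upto n f ->
  continuous (fun kt : K * R => f kt.1 kt.2).
Proof. by case: n => [|n] []. Qed.

Lemma smooth_uptoW n f : smooth_upto n.+1 f -> smooth_upto n f.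
Proof.
elim: n f => [f [cf _] //|n IHn f [cf [df sf]]]; split => //; split => //.
exact: IHn.
Qed.

(** Lets the derivative be supplied by any convenient formula instead of [derive1]. *)
Lemma smooth_upto_intro n f f' : continuous (fun kt : K * R => f kt.1 kt.2) ->
  (forall k (t : R), is_derive t 1 (f k) (f' k t)) -> smooth_upto n f' ->
  smooth_upto n.+1 f.
Proof.
move=> cf df sf; split => //; split => [k t|].
  by case: (df k t).
suff -> : (fun k => derive1 (f k)) = f' by [].
by apply/funext => k; apply/funext => t; rewrite derive1E; apply: derive_val.
Qed.

Lemma smooth_upto_derive n f k (t : R) : smooth_upto n.+1 f ->
  is_derive t 1 (f k) (derive1 (f k) t).
Proof. by move=> [_ [df _]]; rewrite derive1E; apply: derivableP. Qed.

Lemma smooth_upto_cst n (c : K -> R) : continuous c ->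
  smooth_upto n (fun k _ => c k).
Proof.
elim: n c => [|n IHn] c cc.
  split => // kt; apply: (@continuous_comp _ _ _ fst c kt); last exact: cc.
  exact: cvg_fst.
apply: (@smooth_upto_intro _ _ (fun=> cst 0)); last 1 first.
- by apply: (IHn (fun=> 0)) => k; exact: cvg_cst.
- exact: smooth_upto_cont (IHn _ cc).
Qed.

Lemma smooth_uptoD n f g : smooth_upto n f -> smooth_upto n g ->
  smooth_upto n (fun k t => f k t + g k t).
Proof.
elim: n f g => [|n IHn] f g sf sg.
  by split => // kt; apply: (@continuousD _ R^o); [exact: sf.1|exact: sg.1].
apply: (@smooth_upto_intro _ _ (fun k t => derive1 (f k) t + derive1 (g k) t)).
- exact: smooth_upto_cont (IHn _ _ (smooth_uptoW sf) (smooth_uptoW sg)).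
- move=> k t; have := smooth_upto_derive k t sf; have := smooth_upto_derive k t sg.
  by move=> ? ?; exact: is_deriveD.
- by apply: IHn; [case: sf => _ []|case: sg => _ []].
Qed.


Lemma smooth_uptoM n f g : smooth_upto n f -> smooth_upto n g ->
  smooth_upto n (fun k t => f k t * g k t).
Proof.
elim: n f g => [|n IHn] f g sf sg.
  by split => // kt; apply: continuousM; [exact: sf.1|exact: sg.1].
apply: (@smooth_upto_intro _ _
  (fun k t => f k t * derive1 (g k) t + g k t * derive1 (f k) t)).
- exact: smooth_upto_cont (IHn _ _ (smooth_uptoW sf) (smooth_uptoW sg)).
- move=> k t; have := smooth_upto_derive k t sf; have := smooth_upto_derive k t sg.
  by move=> ? ?; exact: is_deriveM.
- apply: smooth_uptoD; apply: IHn; do ?[exact: smooth_uptoW].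
  + by case: sg => _ [].
  + by case: sf => _ [].
Qed.

(** The derivative of the inverse is a product of the inverse itself, known to order n by induction,
    and of the derivative of [f]. *)
Lemma smooth_uptoV n f : (forall k t, f k t != 0) -> smooth_upto n f ->
  smooth_upto n (fun k t => (f k t)^-1).
Proof.
move=> f0; elim: n => [sf|n IHn sf].
  by split => // kt; apply: continuousV; [exact: f0|exact: sf.1].
have h := IHn (smooth_uptoW sf).
apply: (@smooth_upto_intro _ _
  (fun k t => - 1 * ((f k t)^-1 * ((f k t)^-1 * derive1 (f k) t)))).
- exact: smooth_upto_cont h.
- move=> k t; have df := smooth_upto_derive k t sf.
  split; first by apply: derivableV => //; case: df.
  rewrite deriveV// derive1E mulN1r scaleNr -exprVn expr2; congr (- _).
  exact: esym (mulrA _ _ _).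
- apply: smooth_uptoM; first by apply: smooth_upto_cst => ?; exact: cvg_cst.
  do 2![apply: smooth_uptoM => //].
  by case: sf => _ [].
Qed.

(** Proved together because, up to sign, each function occurs in the derivative of the other. *)
Lemma smooth_upto_sincos n f : smooth_upto n f ->
  smooth_upto n (fun k t => cos (f k t)) /\ smooth_upto n (fun k t => sin (f k t)).
Proof.
elim: n => [sf|n IHn sf].
  split; split => // kt; apply: (continuous_comp (sf.1 kt)).
    exact: continuous_cos.
  exact: continuous_sin.
have [hc hs] := IHn (smooth_uptoW sf).
have df' : smooth_upto n (fun k => derive1 (f k)) by case: sf => _ [].
split.
- apply: (@smooth_upto_intro _ _ (fun k t => - 1 * (sin (f k t) * derive1 (f k) t))).
  + exact: smooth_upto_cont hc.
  + move=> k t; have df := smooth_upto_derive k t sf.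
    have := is_derive1_comp (is_derive_cos (f k t)) df.
    by rewrite mulN1r -mulNr.
  + apply: smooth_uptoM; first by apply: smooth_upto_cst => ?; exact: cvg_cst.
    exact: smooth_uptoM.
- apply: (@smooth_upto_intro _ _ (fun k t => cos (f k t) * derive1 (f k) t)).
  + exact: smooth_upto_cont hs.
  + move=> k t; have df := smooth_upto_derive k t sf.
    exact: is_derive1_comp (is_derive_sin (f k t)) df.
  + exact: smooth_uptoM.
Qed.

Lemma smooth_upto_atan n f : smooth_upto n f -> smooth_upto n (fun k t => atan (f k t)).
Proof.
elim: n => [sf|n IHn sf].
  split => // kt; apply: (continuous_comp (sf.1 kt)).
  exact: continuous_atan.
apply: (@smooth_upto_intro _ _ (fun k t => (1 + f k t * f k t)^-1 * derive1 (f k) t)).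
- exact: smooth_upto_cont (IHn (smooth_uptoW sf)).
- move=> k t; have df := smooth_upto_derive k t sf.
  have := is_derive1_comp (is_derive1_atan (f k t)) df.
  by rewrite -expr2.
- have sf' := smooth_uptoW sf.
  apply: smooth_uptoM; last by case: sf => _ [].
  apply: smooth_uptoV.
    by move=> k t; rewrite gt_eqF// ltr_wpDr// -expr2 sqr_ge0.
  apply: smooth_uptoD; first by apply: smooth_upto_cst => ?; exact: cvg_cst.
  exact: smooth_uptoM.
Qed.


Lemma smooth_cst (c : K -> R) : continuous c -> smooth_family (fun k _ => c k).
Proof. by move=> cc n; exact: smooth_upto_cst. Qed.

Lemma smoothD f g : smooth_family f -> smooth_family g ->
  smooth_family (fun k t => f k t + g k t).
Proof. by move=> sf sg n; exact: smooth_uptoD. Qed.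

Lemma smoothM f g : smooth_family f -> smooth_family g ->
  smooth_family (fun k t => f k t * g k t).
Proof. by move=> sf sg n; exact: smooth_uptoM. Qed.

Lemma smoothN f : smooth_family f -> smooth_family (fun k t => - f k t).
Proof.
move=> sf; rewrite (_ : (fun k t => - f k t) = (fun k t => - 1 * f k t)).
  by apply: smoothM => //; apply: smooth_cst => ?; exact: cvg_cst.
by apply/funext => k; apply/funext => t; rewrite mulN1r.
Qed.

Lemma smoothB f g : smooth_family f -> smooth_family g ->
  smooth_family (fun k t => f k t - g k t).
Proof. by move=> sf sg; exact: smoothD sf (smoothN sg). Qed.

Lemma smoothV f : (forall k t, f k t != 0) -> smooth_family f ->
  smooth_family (fun k t => (f k t)^-1).
Proof. by move=> f0 sf n; exact: smooth_uptoV. Qed.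

Lemma smooth_cos f : smooth_family f -> smooth_family (fun k t => cos (f k t)).
Proof. by move=> sf n; case: (smooth_upto_sincos (sf n)). Qed.

Lemma smooth_sin f : smooth_family f -> smooth_family (fun k t => sin (f k t)).
Proof. by move=> sf n; case: (smooth_upto_sincos (sf n)). Qed.

Lemma smooth_atan f : smooth_family f -> smooth_family (fun k t => atan (f k t)).
Proof. by move=> sf n; exact: smooth_upto_atan. Qed.

Lemma smooth_id : smooth_family (fun (_ : K) t => t).
Proof.
case=> [|n]; first by split => // kt; exact: cvg_snd.
apply: (@smooth_upto_intro _ _ (fun=> cst 1)).
  by move=> kt; exact: cvg_snd.
by apply: smooth_upto_cst => ?; exact: cvg_cst.
Qed.

Lemma smooth_sum n (F : 'I_n -> K -> R -> R) :
  (forall i, smooth_family (F i)) ->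
  smooth_family (fun k t => \sum_(i < n) F i k t).
Proof.
elim: n F => [|n IHn] F sF.
  rewrite (_ : (fun k t => _) = (fun _ _ => 0)).
    by apply: smooth_cst => ?; exact: cvg_cst.
  by apply/funext => k; apply/funext => t; rewrite big_ord0.
rewrite (_ : (fun k t => _) =
    (fun k t => F ord0 k t + \sum_(i < n) F (lift ord0 i) k t)).
  by apply: smoothD => //; apply: IHn.
by apply/funext => k; apply/funext => t; rewrite big_ord_recl.
Qed.

Lemma smooth_continuous f : smooth_family f -> continuous (fun kt : K * R => f kt.1 kt.2).
Proof. by move=> /(_ 0)/smooth_upto_cont. Qed.

Lemma smooth_is_derive f k (t : R) : smooth_family f ->
  is_derive t 1 (f k) (derive1 (f k) t).
Proof. by move=> /(_ 1); exact: smooth_upto_derive. Qed.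

Lemma smooth_derive f : smooth_family f -> smooth_family (fun k => derive1 (f k)).
Proof. by move=> sf n; case: (sf n.+1) => _ []. Qed.

Lemma smooth_derive1n f n : smooth_family f -> smooth_family (fun k => derive1n n (f k)).
Proof. by move=> sf; elim: n => [//|n IHn]; exact: smooth_derive. Qed.

Lemma smooth_family_derive1n f :
  (forall n, (forall k t, derivable (derive1n n (f k)) t 1) /\
     continuous (fun kt : K * R => derive1n n (f kt.1) kt.2)) ->
  smooth_family f.
Proof.
move=> hf n; elim: n f hf => [|n IHn] f hf; first by split => //; have [] := hf 0.
split; first by have [] := hf 0.
split; first by have [] := hf 0.
apply: IHn => m; have [df cf] := hf m.+1.
by split => [k t|kt]; [have := df k t|have := cf kt]; rewrite ?derive1Sn//;
  under [X in continuous_at _ X]eq_fun do rewrite derive1Sn.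
Qed.

Lemma derive1_unique f k (t d : R) : is_derive t 1 (f k) d -> derive1 (f k) t = d.
Proof. by rewrite derive1E; case. Qed.

End smooth_family.

Lemma smooth_comp (R : realType) (K K' : topologicalType) (h : K' -> K)
    (f : K -> R -> R) :
  continuous h -> smooth_family f -> smooth_family (fun k => f (h k)).
Proof.
move=> ch sf; apply: smooth_family_derive1n => n.
have sn := smooth_derive1n n sf.
split=> [k t|[k t]]; first by case: (smooth_is_derive (h k) t sn).
apply: (@continuous_comp _ _ _ (fun kt : K' * R => (h kt.1, kt.2))
  (fun kt => derive1n n (f kt.1) kt.2)); last exact: (smooth_continuous sn).
apply: continuous_at_pair; last exact: continuous_snd.
by apply: (@continuous_comp _ _ _ fst h); [exact: continuous_fst|exact: ch].
Qed.

(** * Angles and winding numbers in the plane *)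

Section plane.
Context {R : realType}.
Implicit Types z w x : R * R.

Definition rotation (a : R) z : R * R :=
  (z.1 * cos a - z.2 * sin a, z.1 * sin a + z.2 * cos a).
Definition dot z w : R := z.1 * w.1 + z.2 * w.2.
Definition cross z w : R := z.1 * w.2 - z.2 * w.1.
(* The angle from z to w, but only when dot z w > 0. *)
Definition ang z w : R := atan (cross z w / dot z w).
(** Angles are defined modulo 2pi only; as a relation, [a] can be any determination of the angle
    from [z] to [w]. *)
Definition dir (a : R) z w : Prop :=
  exists2 r, 0 < r & w = (r * (rotation a z).1, r * (rotation a z).2).

Lemma plane_neq0 z : (z != 0) = (0 < dot z z).
Proof.
rewrite /dot -!expr2 lt0r addr_ge0 ?sqr_ge0// andbT.
rewrite paddr_eq0 ?sqr_ge0// !sqrf_eq0; by case: z.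
Qed.

Lemma rotationD a b z : rotation (a + b) z = rotation b (rotation a z).
Proof. by rewrite /rotation cosD sinD /=; congr pair; ring. Qed.

Lemma rotation0 z : rotation 0 z = z.
Proof. by case: z => a b; rewrite /rotation cos0 sin0 /=; congr pair; ring. Qed.

Lemma dot_rotation a z w : dot (rotation a z) (rotation a w) = dot z w.
Proof.
rewrite /dot /rotation /=.
transitivity ((z.1 * w.1 + z.2 * w.2) * (cos a ^+ 2 + sin a ^+ 2)); first ring.
by rewrite cos2Dsin2 mulr1.
Qed.

Lemma dir_trans a b z w x : dir a z w -> dir b w x -> dir (a + b) z x.
Proof.
move=> [r r0 ->] [s s0 ->]; exists (s * r); first exact: mulr_gt0.
by rewrite rotationD /rotation /=; congr pair; ring.
Qed.

Lemma dir_refl z : dir 0 z z.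
Proof. by exists 1 => //; rewrite rotation0 !mul1r; case: z. Qed.

Lemma dir_ang z w : 0 < dot z w -> dir (ang z w) z w.
Proof.
move=> d0; set a := ang z w.
have c0 : 0 < cos a by rewrite cos_gt0_pihalf// atan_gtNpi2 atan_ltpi2.
have sa : sin a = cross z w / dot z w * cos a.
  by rewrite -[cross z w / _]atanK -/(ang z w) -/a /tan divfK// gt_eqF.
have z0 : 0 < dot z z.
  rewrite -plane_neq0; apply: contraTN d0 => /eqP ->.
  by rewrite /dot !mul0r addr0 ltxx.
(* The factor r is forced by dot z w = r cos a |z|^2. *)
exists (dot z w / (cos a * dot z z)); first by rewrite divr_gt0// mulr_gt0.
rewrite /rotation /= sa [LHS]surjective_pairing; move: d0 z0 (gt_eqF c0) (gt_eqF d0) (gt_eqF z0).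
rewrite /dot /cross => d0 z0 /negbT e1 /negbT e2 /negbT e3.
by congr pair; field; rewrite e1 e2 e3.
Qed.

(** After reduction to [0, 2pi), an angle beyond pi is reflected to 2pi - b, so that injectivity of
    the cosine on [0, pi] decides both cases. *)
Lemma cos_eq1 (a : R) : cos a = 1 -> exists k : int, a = pi *+ 2 * k%:~R.
Proof.
move=> ca; have [k /andP[k0 k1]] := angle_reduce a.
exists (- k); apply/eqP; rewrite mulrNz mulrN -subr_eq0 opprK; apply/eqP.
set b := a + _ in k0 k1 *.
have cb : cos b = 1 by rewrite /b periodic_int//; exact: cosD2pi.
have [bpi|bpi] := leP b pi.
  by apply: cos_inj; rewrite ?in_itv/= ?lexx ?k0 ?pi_ge0// cos0.
have : pi *+ 2 - b = 0.
  apply: cos_inj; rewrite ?in_itv/= ?lexx ?pi_ge0//.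
    by rewrite subr_ge0 ltW//= lerBlDr mulr2n lerD2l ltW.
  by rewrite addrC cosD2pi cosN cos0.
by move=> /eqP; rewrite subr_eq0 => /eqP e; rewrite e ltxx in k1.
Qed.

(** Comparing norms gives r = s, so both rotations send [z] to the same vector; their inner product
    is cos (a - b) |z|^2, whence cos (a - b) = 1. *)
Lemma dir_unique a b z w : z != 0 -> dir a z w -> dir b z w ->
  exists k : int, a - b = pi *+ 2 * k%:~R.
Proof.
rewrite plane_neq0 => z0 [r r0 ->] [s s0 [e1 e2]]; apply: cos_eq1.
have rs : r = s.
  have : r ^+ 2 * dot z z = s ^+ 2 * dot z z.
    rewrite -[in LHS](dot_rotation a) -[in RHS](dot_rotation b) /dot.
    transitivity ((r * (rotation a z).1) ^+ 2 + (r * (rotation a z).2) ^+ 2); first ring.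
    by rewrite e1 e2 /rotation /=; ring.
  move=> /(mulIf (lt0r_neq0 z0))/eqP; rewrite eqf_sqr => /orP[/eqP//|/eqP]; lra.
move: e1 e2; rewrite rs => /(mulfI (lt0r_neq0 s0)) + /(mulfI (lt0r_neq0 s0)).
rewrite cosB; move: z0; rewrite /rotation /dot /=; case: z => x y /= z0 e1 e2.
have e : (cos a * cos b + sin a * sin b) * (x * x + y * y) =
    (x * cos a - y * sin a) * (x * cos b - y * sin b) +
    (x * sin a + y * cos a) * (x * sin b + y * cos b) by ring.
apply: (mulIf (lt0r_neq0 z0)); rewrite e e1 e2 mul1r.
transitivity ((x * x + y * y) * (cos b ^+ 2 + sin b ^+ 2)); first ring.
by rewrite cos2Dsin2 mulr1.
Qed.

(** If the end values differed, the intermediate value theorem would produce the value c (k + 1/2),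
    and an even integer would equal an odd one. *)
Lemma integer_valued_cst (h : R -> R) (c : R) : continuous h -> 0 < c ->
  (forall s, 0 <= s <= 1 -> exists k : int, h s = c * k%:~R) -> h 1 = h 0.
Proof.
move=> ch c0 hk.
have [k0 e0] : exists k : int, h 0 = c * k%:~R by apply: hk; rewrite lexx ler01.
have [k1 e1] : exists k : int, h 1 = c * k%:~R by apply: hk; rewrite lexx ler01.
have mid (k : int) v : v = c * (k%:~R + 2^-1) ->
    Num.min (h 0) (h 1) <= v <= Num.max (h 0) (h 1) -> False.
  move=> ve vI.
  have [s] := IVT ler01 (continuous_subspaceT ch) vI.
  rewrite in_itv/= => /hk[j ->]; rewrite ve => /(mulfI (lt0r_neq0 c0)) e.
  have : (2 * j)%:~R = (2 * k + 1)%:~R :> R by rewrite intrD !intrM e; field.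
  by move=> /intr_inj; lia.
have [k01|k01|e01] := ltgtP k0 k1; last by rewrite e0 e1 e01.
- exfalso; apply: (mid k0 _ erefl); rewrite e0 e1 ge_min le_max !ler_pM2l//.
  have : (k0 + 1)%:~R <= k1%:~R :> R by rewrite ler_int lezD1.
  rewrite intrD => h1; apply/andP; split; apply/orP; [left|right]; lra.
- exfalso; apply: (mid k1 _ erefl); rewrite e0 e1 ge_min le_max !ler_pM2l//.
  have : (k1 + 1)%:~R <= k0%:~R :> R by rewrite ler_int lezD1.
  rewrite intrD => h1; apply/andP; split; apply/orP; [right|left]; lra.
Qed.

End plane.

(** * Continuous angles along paths: construction, uniqueness and homotopy invariance *)

Section lifts.
Context {R : realType}.
Local Notation I := (unit_itv R).
Local Notation P := (R * R)%type.

Lemma clamp_lipschitz (x y : R) :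
  `|itv_val (clamp x) - itv_val (clamp y)| <= `|x - y|.
Proof.
wlog xy : x y / x <= y.
  move=> h; have [|/ltW] := leP x y; first exact: h.
  by move=> yx; rewrite distrC [leRHS]distrC; apply: h.
have e (u : R) : itv_val (clamp u) = Num.max 0 (Num.min 1 u) by [].
rewrite !e distrC [leRHS]distrC [leRHS]ger0_norm ?subr_ge0//.
rewrite ger0_norm ?subr_ge0.
  have [y1|y1] := leP 1 y; have [x1|x1] := leP 1 x;
  by rewrite ?maxEle; do ?case: ifPn; lra.
have [y1|y1] := leP 1 y; have [x1|x1] := leP 1 x;
  by rewrite ?maxEle; do ?case: ifPn; lra.
Qed.

Lemma compact_itv_setT : compact [set: I].
Proof.
have -> : [set: I] = clamp @` `[0, 1].
  rewrite predeqE => s; split => // _; exists (itv_val s); last exact: itv_valK.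
  by rewrite /= in_itv /= itv_val_ge0 itv_val_le1.
apply: continuous_compact; last exact: segment_compact.
exact/continuous_subspaceT/clamp_continuous.
Qed.

Lemma dot_continuous (T : topologicalType) (f g : T -> P) :
  continuous f -> continuous g -> continuous (fun t => dot (f t) (g t)).
Proof.
move=> cf cg t.
have c1 (h : T -> P) : continuous h -> continuous (fun t => (h t).1).
  by move=> ch u; apply: (continuous_comp (ch u)); exact: continuous_fst.
have c2 (h : T -> P) : continuous h -> continuous (fun t => (h t).2).
  by move=> ch u; apply: (continuous_comp (ch u)); exact: continuous_snd.
apply: (@continuousD R R^o _ (fun t => (f t).1 * (g t).1) (fun t => (f t).2 * (g t).2)); apply: continuousM;
  by [exact: c1|exact: c2].
Qed.

Lemma cross_continuous (T : topologicalType) (f g : T -> P) :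
  continuous f -> continuous g -> continuous (fun t => cross (f t) (g t)).
Proof.
move=> cf cg t.
have c1 (h : T -> P) : continuous h -> continuous (fun t => (h t).1).
  by move=> ch u; apply: (continuous_comp (ch u)); exact: continuous_fst.
have c2 (h : T -> P) : continuous h -> continuous (fun t => (h t).2).
  by move=> ch u; apply: (continuous_comp (ch u)); exact: continuous_snd.
apply: (@continuousB R R^o _ (fun t => (f t).1 * (g t).2) (fun t => (f t).2 * (g t).1)); apply: continuousM;
  by [exact: c1|exact: c2].
Qed.

Lemma ang_continuous (T : topologicalType) (f g : T -> P) :
  continuous f -> continuous g -> (forall t, 0 < dot (f t) (g t)) ->
  continuous (fun t => ang (f t) (g t)).
Proof.
move=> cf cg fg0 t.
apply: (@continuous_comp _ _ _ (fun t => cross (f t) (g t) / dot (f t) (g t))).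
  apply: continuousM; first exact: cross_continuous.
  by apply: continuousV; [rewrite gt_eqF|exact: dot_continuous].
exact: continuous_atan.
Qed.

Lemma ang_id (z : P) : ang z z = 0.
Proof. by rewrite /ang /cross [z.1 * z.2]mulrC subrr mul0r atan0. Qed.

(** On the diagonal x = x' the inner product is |z|^2 > 0, and it stays positive nearby; compactness
    of [0, 1] x A gives one step 1/m for all parameters. A common m is what makes the lifts below
    depend continuously on [t]. *)
Lemma uniform_subdivision (T : topologicalType) (A : set T) (z : I -> T -> P) :
  compact A -> continuous (fun st : I * T => z st.1 st.2) ->
  (forall s t, z s t != 0) ->
  exists2 m : nat, (0 < m)%N & forall (x x' : R) t, A t ->
    `|x' - x| * m%:R <= 1 -> 0 < dot (z (clamp x) t) (z (clamp x') t).
Proof.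
move=> cA cz z0.
pose Q (m : nat) (xt : R * T) := forall x', `|x' - xt.1| * m.+1%:R <= 1 ->
  0 < dot (z (clamp xt.1) xt.2) (z (clamp x') xt.2).
have cz' : continuous (fun xt : R * T => z (clamp xt.1) xt.2).
  move=> xt; apply: (@continuous_comp _ _ _ (fun xt : R * T => (clamp xt.1, xt.2))
    (fun st : I * T => z st.1 st.2)); last exact: cz.
  apply: continuous_at_pair; last exact: continuous_snd.
  apply: (@continuous_comp _ _ _ fst (@clamp R)); first exact: continuous_fst.
  exact: clamp_continuous.
have : \forall m \near \oo, `[0, 1] `*` A `<=` Q m.
  have := compact_setX (@segment_compact R 0 1) cA.
  move=> /compact_near_coveringP/(_ nat \oo Q); apply => -[x0 t0] _.
  pose G (xxt : (R * R) * T) :=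
    dot (z (clamp xxt.1.1) xxt.2) (z (clamp xxt.1.2) xxt.2).
  have cG : continuous G.
    apply: dot_continuous => xxt.
    - apply: (@continuous_comp _ _ _ (fun xxt : (R * R) * T => (xxt.1.1, xxt.2))
        (fun xt : R * T => z (clamp xt.1) xt.2)); last exact: cz'.
      apply: continuous_at_pair; last exact: continuous_snd.
      by apply: (@continuous_comp _ _ _ fst fst); exact: continuous_fst.
    - apply: (@continuous_comp _ _ _ (fun xxt : (R * R) * T => (xxt.1.2, xxt.2))
        (fun xt : R * T => z (clamp xt.1) xt.2)); last exact: cz'.
      apply: continuous_at_pair; last exact: continuous_snd.
      by apply: (@continuous_comp _ _ _ fst snd);
        [exact: continuous_fst|exact: continuous_snd].
  have : \forall xxt \near ((x0, x0), t0), 0 < G xxt.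
    by apply: (cvgr_gt _ (cG (x0, x0, t0))); rewrite /G/= -plane_neq0.
  move=> [[U W] /= [[[U1 U2] /= [/nbhs_ballP[e1 /= e10 h1] /nbhs_ballP[e2 /= e20 h2]] U12] Wt] UW].
  (* Half the radius: [x'] is within e of [x], which is itself within e of [x0]. *)
  pose e := Num.min e1 e2 / 2.
  have e0 : 0 < e by rewrite divr_gt0// lt_min e10 e20.
  exists (ball x0 e `*` W, [set m | m.+1%:R^-1 < e]).
    split => /=; last exact: (near_infty_natSinv_lt (PosNum e0)).
    by exists (ball x0 e, W) => //=; split => //; exact: nbhsx_ballx.
  move=> [[x t] m] /= [[xe Wt'] me] x' xx'.
  have e12 : 2 * e <= e1 /\ 2 * e <= e2.
    by rewrite /e mulrC divfK//; split; rewrite ge_min lexx ?orbT.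
  apply: (UW ((x, x'), t)); split => //; apply: U12; split => /=.
    by apply: h1; apply: le_ball xe; lra.
  apply: h2; move: xe; rewrite /ball/= => xe.
  have : `|x' - x| < e.
    by apply: le_lt_trans me; rewrite -[leRHS]mul1r ler_pdivlMr.
  move=> xe'; apply: (@lt_le_trans _ _ (2 * e)); last lra.
  rewrite (_ : x0 - x' = (x0 - x) - (x' - x)); last ring.
  by apply: le_lt_trans (ler_normB _ _) _; lra.
move=> [m _ /(_ m (leqnn m)) hm]; exists m.+1 => // x x' t At xx'.
(* Points off [0, 1] are replaced with their clamped values, which brings them no farther apart. *)
rewrite -[clamp x]itv_valK -[clamp x']itv_valK.
apply: (hm (itv_val (clamp x), t)).
  by split => //=; rewrite in_itv/= itv_val_ge0 itv_val_le1.
apply: le_trans xx' => /=; rewrite ler_wpM2r//; exact: clamp_lipschitz.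
Qed.

(** For every s the segment [0, s] is cut into the same number m of equal pieces, and the small
    angles along it are added. The lift is thus a fixed finite sum of arctangents, which inherits
    continuity and smoothness in all parameters from [z]. *)
Definition angle_lift (m : nat) (z : I -> P) (s : I) : R :=
  \sum_(j < m) ang (z (clamp (itv_val s * (j%:R / m%:R))))
                   (z (clamp (itv_val s * (j.+1%:R / m%:R)))).

Definition fine_subdivision (m : nat) (z : I -> P) : Prop := (0 < m)%N /\
  forall x x' : R, `|x' - x| * m%:R <= 1 -> 0 < dot (z (clamp x)) (z (clamp x')).

Lemma fine_step m z s (j : nat) : fine_subdivision m z ->
  0 < dot (z (clamp (itv_val s * (j%:R / m%:R))))
          (z (clamp (itv_val s * (j.+1%:R / m%:R)))).
Proof.
move=> [m0]; apply; rewrite -mulrBr -mulrBl -(natrB _ (leqnSn j)) subSnn.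
have mr : 0 < m%:R :> R by rewrite ltr0n.
rewrite mul1r normrM normfV (gtr0_norm mr) -mulrA mulVf ?gt_eqF// mulr1.
by rewrite ger0_norm ?itv_val_ge0// itv_val_le1.
Qed.

Lemma angle_lift0 m z : angle_lift m z zero = 0.
Proof. by apply: big1 => j _; rewrite itv_val_zero !mul0r ang_id. Qed.

Lemma angle_lift_dir m z s : fine_subdivision m z -> dir (angle_lift m z s) (z zero) (z s).
Proof.
move=> fz.
suff h (i : nat) : dir (\sum_(j < i) ang (z (clamp (itv_val s * (j%:R / m%:R))))
    (z (clamp (itv_val s * (j.+1%:R / m%:R))))) (z zero)
    (z (clamp (itv_val s * (i%:R / m%:R)))).
  have := h m; rewrite divff ?pnatr_eq0 -?lt0n; last by case: fz.
  by rewrite mulr1 itv_valK.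
elim: i => [|i IHi].
  by rewrite big_ord0 mul0r mulr0 -itv_zeroE; exact: dir_refl.
by rewrite big_ord_recr/=; apply: dir_trans IHi _; exact/dir_ang/fine_step.
Qed.


Lemma continuous_sum_ord (T : topologicalType) n (F : 'I_n -> T -> R) :
  (forall i, continuous (F i)) -> continuous (fun t => \sum_(i < n) F i t).
Proof.
elim: n F => [|n IHn] F cF.
  rewrite (_ : (fun t => _) = (fun=> 0)) => [t|]; first exact: cvg_cst.
  by apply/funext => t; rewrite big_ord0.
rewrite (_ : (fun t => _) = (fun t => F ord0 t + \sum_(i < n) F (lift ord0 i) t)).
  move=> t; apply: (@continuousD R R^o T (F ord0)); first exact: cF.
  by apply: IHn => i; exact: cF.
by apply/funext => t; rewrite big_ord_recl.
Qed.

Lemma scale_clamp_continuous (a : R) : continuous (fun s : I => clamp (itv_val s * a)).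
Proof.
apply: continuous_clamp_comp => s.
by apply: (@continuousM R I (@itv_val R) (cst a)); [exact: itv_val_continuous|exact: cst_continuous].
Qed.

Lemma angle_lift_continuous (T : topologicalType) m (z : I -> T -> P) :
  continuous (fun st : I * T => z st.1 st.2) ->
  (forall t, fine_subdivision m (z ^~ t)) ->
  continuous (fun st : I * T => angle_lift m (z ^~ st.2) st.1).
Proof.
move=> cz fz; apply: continuous_sum_ord => j.
have c (a : R) : continuous (fun st : I * T => z (clamp (itv_val st.1 * a)) st.2).
  move=> st; apply: (@continuous_comp _ _ _
    (fun st : I * T => (clamp (itv_val st.1 * a), st.2))
    (fun st : I * T => z st.1 st.2)); last exact: cz.
  apply: continuous_at_pair; last exact: continuous_snd.
  apply: (@continuous_comp _ _ _ fst (fun s : I => clamp (itv_val s * a))).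
    exact: continuous_fst.
  exact: scale_clamp_continuous.
apply: ang_continuous => [||st]; [exact: c|exact: c|].
exact: (fine_step _ _ (fz st.2)).
Qed.

Lemma angle_lift_smooth m (z1 z2 : I -> R -> R) :
  smooth_family z1 -> smooth_family z2 ->
  (forall t, fine_subdivision m (fun s => (z1 s t, z2 s t))) ->
  smooth_family (fun s t => angle_lift m (fun x => (z1 x t, z2 x t)) s).
Proof.
move=> s1 s2 fz; apply: smooth_sum => j; apply: smooth_atan.
have c (a : R) := @scale_clamp_continuous a.
apply: smoothM; first by apply: smoothB; apply: smoothM; exact: smooth_comp.
apply: smoothV; last by apply: smoothD; apply: smoothM; exact: smooth_comp.
move=> s t; rewrite gt_eqF//.
by have := fine_step s j (fz t).
Qed.

Definition is_lift (z : I -> P) (D : I -> R) : Prop :=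
  [/\ continuous D, D zero = 0 & forall s, dir (D s) (z zero) (z s)].

(** A relation, so that an explicitly given lift can witness the winding number. *)
Definition wind (z : I -> P) (k : int) : Prop :=
  exists2 D, is_lift z D & D one = pi *+ 2 * k%:~R.

(** The difference of two lifts is continuous, has values in 2pi Z and starts at 0. *)
Lemma is_lift_unique (z : I -> P) D D' : z zero != 0 -> is_lift z D -> is_lift z D' ->
  D one = D' one.
Proof.
move=> z0 [cD D0 hD] [cD' D'0 hD'].
apply/eqP; rewrite -subr_eq0; apply/eqP.
have := @integer_valued_cst R (fun x => D (clamp x) - D' (clamp x)) (pi *+ 2) _ pi2_gt0.
rewrite -itv_zeroE -itv_oneE D0 D'0 subr0; apply.
  move=> x; apply: (@continuousB R R^o _ (fun x => D (clamp x)) (fun x => D' (clamp x))).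
    by apply: (@continuous_comp _ _ _ (@clamp R)); [exact: clamp_continuous|exact: cD].
  by apply: (@continuous_comp _ _ _ (@clamp R)); [exact: clamp_continuous|exact: cD'].
by move=> s _; apply: (dir_unique z0).
Qed.

Lemma wind_unique (z : I -> P) k k' : z zero != 0 -> wind z k -> wind z k' -> k = k'.
Proof.
move=> z0 [D lD D1] [D' lD' D'1]; apply: (@intr_inj R).
have := is_lift_unique z0 lD lD'; rewrite D1 D'1 => /mulfI; apply.
by rewrite gt_eqF// pi2_gt0.
Qed.

Lemma is_lift_closed (z : I -> P) D : z zero != 0 -> z one = z zero -> is_lift z D ->
  exists k : int, D one = pi *+ 2 * k%:~R.
Proof.
move=> z0 z1 [_ _ /(_ one)]; rewrite z1 => d.
by have [k] := dir_unique z0 d (dir_refl _); rewrite subr0; exists k.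
Qed.

Lemma wind_exists (z : I -> P) : continuous z -> (forall s, z s != 0) -> z one = z zero ->
  exists k, wind z k.
Proof.
move=> cz z0 z1.
have cz' := continuousT_comp (@continuous_fst I R) cz.
have [m m0 hm] := @uniform_subdivision R [set 0] (fun s _ => z s) (@compact_set1 _ _)
  cz' (fun s _ => z0 s).
have fz : fine_subdivision m z by split => // x x'; exact: (hm _ _ 0).
have lD : is_lift z (angle_lift m z).
  split; [|exact: angle_lift0|by move=> s; exact: angle_lift_dir].
  apply: (continuousT_comp (f := fun s => (s, 0)) (g := fun st : I * R => angle_lift m z st.1)).
    by apply: continuousT_pair; [by move=> ?; exact: cvg_id|exact: cst_continuous].
  exact: (@angle_lift_continuous R m (fun s _ => z s) cz' (fun=> fz)).
have [k hk] := is_lift_closed (z0 _) z1 lD.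
by exists k, (angle_lift m z).
Qed.

(** One subdivision serves all stages of the homotopy, so the final value of the lift is continuous
    in the stage; as the paths are closed it lies in 2pi Z, hence is constant. *)
Lemma wind_homotopy (H : I * I -> P) k : continuous H -> (forall u, H u != 0) ->
  (forall s, H (s, one) = H (s, zero)) ->
  wind (fun t => H (zero, t)) k -> wind (fun t => H (one, t)) k.
Proof.
move=> cH H0 Hl hk.
pose z s t := H (t, s).
have cz : continuous (fun st : I * I => z st.1 st.2).
  apply: (continuousT_comp (f := fun st : I * I => (st.2, st.1))) cH.
  by apply: continuousT_pair; [exact: continuous_snd|exact: continuous_fst].
have [m m0 hm] := @uniform_subdivision _ _ z compact_itv_setT cz (fun s t => H0 (t, s)).
have fz t : fine_subdivision m (z ^~ t) by split => // x x'; exact: hm.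
have cD := angle_lift_continuous cz fz.
have cD1 (t : I) : continuous (fun s : I => (s, t)).
  by apply: (@continuousT_pair I I I id (fun=> t)); [move=> ?; exact: cvg_id|exact: cst_continuous].
have cD2 (s : I) : continuous (fun t : I => (s, t)).
  by apply: (@continuousT_pair I I I (fun=> s) id); [exact: cst_continuous|move=> ?; exact: cvg_id].
pose D t s := angle_lift m (z ^~ t) s.
have lD t : is_lift (z ^~ t) (D t).
  split; [|exact: angle_lift0|by move=> s; exact: angle_lift_dir].
  exact: continuousT_comp (cD1 t) cD.
have e : D one one = D zero one.
  have := @integer_valued_cst R (fun x => D (clamp x) one) (pi *+ 2) _ pi2_gt0.
  rewrite -itv_zeroE -itv_oneE; apply.
    exact: continuousT_comp (continuousT_comp (@clamp_continuous R) (cD2 one)) cD.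
  by move=> s _; exact: (is_lift_closed (H0 _) (Hl _) (lD _)).
exists (D one); first exact: lD.
by rewrite e; case: hk => D' lD' <-; exact: (is_lift_unique (H0 _) (lD _) lD').
Qed.

Lemma wind_concat (z z' : I -> P) (w : I -> P) k k' :
  wind z k -> wind z' k' -> z one = z' zero ->
  (forall a, w (clamp a) = if a <= 2^-1 then z (clamp (2 * a)) else z' (clamp (2 * a - 1))) ->
  wind w (k + k').
Proof.
move=> [D [cD D0 hD] D1] [D' [cD' D'0 hD'] D'1] zz' hw.
exists (fun s => if itv_val s <= 2^-1 then D (clamp (2 * itv_val s))
  else D one + D' (clamp (2 * itv_val s - 1))); last first.
  rewrite itv_val_one ifF; last lra.
  by rewrite [clamp (_ - _)]clamp_ge1 -?itv_oneE ?D1 ?D'1 ?intrD ?mulrDr//; lra.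
have w0 : w zero = z zero by rewrite itv_zeroE hw mulr0 ifT//; lra.
split.
- apply: continuous_paste; first exact: itv_val_continuous.
  + apply: continuousT_comp cD.
    exact/continuous_clamp_comp/continuous_double/itv_val_continuous.
  + move=> s; apply: (@continuousD R R^o I (cst (D one))
      (fun s => D' (clamp (2 * itv_val s - 1)))); first exact: cst_continuous.
    apply: (continuousT_comp _ cD').
    exact/continuous_clamp_comp/continuous_affine/itv_val_continuous.
  + by move=> t ->; rewrite divff// subrr -itv_oneE -itv_zeroE D'0 addr0.
- by rewrite itv_val_zero ifT ?mulr0 -?itv_zeroE//; lra.
- move=> s; rewrite w0; have := hw (itv_val s); rewrite itv_valK => ->; case: ifPn => // _.
  by apply: dir_trans (hD one) _; rewrite zz'.
Qed.

End lifts.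

(** * Velocities and rotations of curves *)

Section all_derivable.
Context {R : realType}.

Definition all_derivable (W : normedModType R) (f : R -> W) : Prop :=
  forall n t, derivable (derive1n n f) t 1.

Lemma derive1n_fst (U W : normedModType R) (f : R -> U * W) n :
  all_derivable f -> derive1n n (fun t => (f t).1) = (fun t => (derive1n n f t).1).
Proof.
move=> df; elim: n => [//|n IHn]; rewrite !derive1nS IHn.
apply/funext => t; rewrite !derive1E.
by have [_] := is_derive1_fst (derivableP (df n t)).
Qed.

Lemma derive1n_snd (U W : normedModType R) (f : R -> U * W) n :
  all_derivable f -> derive1n n (fun t => (f t).2) = (fun t => (derive1n n f t).2).
Proof.
move=> df; elim: n => [//|n IHn]; rewrite !derive1nS IHn.
apply/funext => t; rewrite !derive1E.
by have [_] := is_derive1_snd (derivableP (df n t)).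
Qed.

Lemma all_derivable_fst (U W : normedModType R) (f : R -> U * W) :
  all_derivable f -> all_derivable (fun t => (f t).1).
Proof.
move=> df n t; rewrite derive1n_fst//.
by have [] := is_derive1_fst (derivableP (df n t)).
Qed.

Lemma all_derivable_snd (U W : normedModType R) (f : R -> U * W) :
  all_derivable f -> all_derivable (fun t => (f t).2).
Proof.
move=> df n t; rewrite derive1n_snd//.
by have [] := is_derive1_snd (derivableP (df n t)).
Qed.

Lemma derive1n_pair (U W : normedModType R) (f : R -> U) (g : R -> W) n :
  all_derivable f -> all_derivable g ->
  derive1n n (fun t => (f t, g t)) = (fun t => (derive1n n f t, derive1n n g t)).
Proof.
move=> df dg; elim: n => [//|n IHn]; rewrite !derive1nS IHn.
apply/funext => t; rewrite !derive1E.
by have [_] := is_derive1_pair (derivableP (df n t)) (derivableP (dg n t)).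
Qed.

Lemma all_derivable_pair (U W : normedModType R) (f : R -> U) (g : R -> W) :
  all_derivable f -> all_derivable g -> all_derivable (fun t => (f t, g t)).
Proof.
move=> df dg n t; rewrite derive1n_pair//.
by have [] := is_derive1_pair (derivableP (df n t)) (derivableP (dg n t)).
Qed.

Lemma smooth_all_derivable (K : topologicalType) (f : K -> R -> R) k :
  smooth_family f -> all_derivable (f k).
Proof.
by move=> sf n t; case: (smooth_is_derive k t (smooth_derive1n n sf)).
Qed.

End all_derivable.

Section circle.
Context {R : realType}.

Lemma circle_point_surj (z : circle R) : exists t, circle_point t = z.
Proof.
have := svalP z; rewrite inE /=; case zE: (sval z) => [x y] /= xy.
have x1 : -1 <= x <= 1.
  by rewrite -ler_norml -ler_sqr ?nnegrE ?normr_ge0 ?ler01// real_normK ?num_real// expr1n -xy lerDl sqr_ge0.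
have sx : sin (acos x) = `|y|.
  by rewrite sin_acos// -xy addrC addKr sqrtr_sqr.
have cx : cos (acos x) = x by rewrite acosK// in_itv.
have [y0|y0] := leP 0 y.
  exists (acos x); apply: eq_sig_hprop => //=.
  by rewrite cx sx ger0_norm// -zE.
exists (- acos x); apply: eq_sig_hprop => //=.
by rewrite cosN sinN cx sx ltr0_norm// opprK -zE.
Qed.

Lemma circle_point_eq (s t : R) : circle_point s = circle_point t ->
  exists k : int, s = t + pi *+ 2 * k%:~R.
Proof.
move=> /(congr1 sval)[c d].
have [k e] : exists k : int, s - t = pi *+ 2 * k%:~R.
  by apply: cos_eq1; rewrite cosB c d -!expr2 cos2Dsin2.
by exists k; rewrite -e addrC subrK.
Qed.

Lemma angular_inj (f g : torus_curve R) :
  (forall t, angular (sval f) t = angular (sval g) t) -> f = g.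
Proof.
move=> h; apply: eq_sig_hprop => [?|]; first exact: Prop_irrelevance.
apply/funext => z; have [t <-] := circle_point_surj z.
have := h t; rewrite /angular /torus_val => -[e1 e2].
by rewrite [LHS]surjective_pairing [RHS]surjective_pairing; congr pair;
  apply: eq_sig_hprop.
Qed.

Lemma angular_norm1 (f : circle R -> torus R) t :
  dot (angular f t).1 (angular f t).1 = 1 /\ dot (angular f t).2 (angular f t).2 = 1.
Proof.
rewrite /angular /=; set p := f _.
by split; [have := svalP p.1|have := svalP p.2]; rewrite inE /= /dot -!expr2.
Qed.

End circle.

Section velocity.
Context {R : realType}.
Implicit Type f : torus_curve R.

(** The angular velocities of the two circle coordinates, that is, the velocity in the
    trivialization of the tangent bundle given by the group structure of the torus: for a unit
    vector a(t), the angular velocity is cross a a'. *)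
Definition curve_vel f (t : R) : R * R :=
  (cross (angular (sval f) t).1 (derive1 (angular (sval f)) t).1,
   cross (angular (sval f) t).2 (derive1 (angular (sval f)) t).2).

Lemma curve_all_derivable f : all_derivable (angular (sval f)).
Proof. by case: (svalP f). Qed.

Lemma unit_curve_derive (a : R -> R * R) da (t : R) :
  (forall t, dot (a t) (a t) = 1) -> is_derive t 1 a da -> dot (a t) da = 0.
Proof.
move=> a1 d.
have d1 := is_derive1_fst d; have d2 := is_derive1_snd d.
have := is_deriveD (is_deriveM d1 d1) (is_deriveM d2 d2).
have -> : (fun u => (a u).1) * (fun u => (a u).1) +
    (fun u => (a u).2) * (fun u => (a u).2) = cst 1 :> (R -> R).
  by apply/funext => u; rewrite -(a1 u).
move=> [_]; rewrite derive_cst /dot /GRing.scale /= => e.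
lra.
Qed.

(** The dot and cross products are the coordinates of [da] in the orthonormal basis formed by [a]
    and its quarter turn. *)
Lemma unit_curve_derive_eq0 (a da : R * R) :
  dot a a = 1 -> dot a da = 0 -> cross a da = 0 -> da = 0.
Proof.
rewrite /dot /cross; case: a => x y; case: da => u v /= a1 d c.
have eu : u = x * (x * u + y * v) - y * (x * v - y * u) :> R.
  by rewrite -[LHS]mul1r -a1; ring.
have ev : v = y * (x * u + y * v) + x * (x * v - y * u) :> R.
  by rewrite -[LHS]mul1r -a1; ring.
by apply: f_equal2; [rewrite eu|rewrite ev]; rewrite d c !mulr0 ?subr0 ?addr0.
Qed.

Lemma curve_vel_neq0 f t : curve_vel f t != 0.
Proof.
have [_ /(_ t)] := svalP f; apply: contraNN => /eqP[c1 c2].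
have := derivableP (@curve_all_derivable f 0 t); rewrite -derive1E => d.
rewrite [derive1 _ _]surjective_pairing; apply/eqP; congr pair.
- apply: unit_curve_derive_eq0 c1; first by case: (angular_norm1 (sval f) t).
  apply: (@unit_curve_derive (fun t => (angular (sval f) t).1)).
    by move=> u; case: (angular_norm1 (sval f) u).
  exact: is_derive1_fst.
- apply: unit_curve_derive_eq0 c2; first by case: (angular_norm1 (sval f) t).
  apply: (@unit_curve_derive (fun t => (angular (sval f) t).2)).
    by move=> u; case: (angular_norm1 (sval f) u).
  exact: is_derive1_snd.
Qed.

End velocity.

Section curve_families.
Context {R : realType} {K : topologicalType}.
Implicit Type g : K -> torus_curve R.
Local Notation V := ((R * R) * (R * R))%type.

Lemma continuous_diffble (f : R -> R) : (forall t, derivable f t 1) -> continuous f.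
Proof. by move=> df t; apply/differentiable_continuous/derivable1_diffP. Qed.

Lemma all_derivable_smooth (f : R -> R) :
  all_derivable f -> smooth_family (fun _ : K => f).
Proof.
move=> df; apply: smooth_family_derive1n => n; split=> [_ t|]; first exact: df.
apply: (continuousT_comp (@continuous_snd K R)).
by apply: continuous_diffble => t; exact: df.
Qed.

Lemma curve_family_smooth g : continuous g ->
  [/\ smooth_family (fun k t => (angular (sval (g k)) t).1.1),
      smooth_family (fun k t => (angular (sval (g k)) t).1.2),
      smooth_family (fun k t => (angular (sval (g k)) t).2.1) &
      smooth_family (fun k t => (angular (sval (g k)) t).2.2)].
Proof.
move=> cg; have cn := continuous_derivatives cg.
have d1 k : all_derivable (fun t => (angular (sval (g k)) t).1).
  exact/all_derivable_fst/curve_all_derivable.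
have d2 k : all_derivable (fun t => (angular (sval (g k)) t).2).
  exact/all_derivable_snd/curve_all_derivable.
have smooth_proj (f : K -> R -> R) (pr : V -> R) : continuous pr ->
    (forall k, all_derivable (f k)) ->
    (forall n k t, derive1n n (f k) t = pr (derive1n n (angular (sval (g k))) t)) ->
    smooth_family f.
  move=> cpr df fE; apply: smooth_family_derive1n => n; split=> [k|].
    exact: df.
  rewrite (_ : (fun kt => _) =
      fun kt : K * R => pr (derive1n n (angular (sval (g kt.1))) kt.2)).
    exact: continuousT_comp (cn n) cpr.
  by apply/funext => kt; rewrite fE.
have d k : all_derivable (angular (sval (g k))) by exact: curve_all_derivable.
split.
- apply: (smooth_proj _ (fun v => v.1.1)) => [|k|n k t].
  + exact: continuousT_comp (@continuous_fst _ _) (@continuous_fst _ _).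
  + exact: all_derivable_fst (d1 k).
  + by rewrite (derive1n_fst n (d1 k)) (derive1n_fst n (d k)).
- apply: (smooth_proj _ (fun v => v.1.2)) => [|k|n k t].
  + exact: continuousT_comp (@continuous_fst _ _) (@continuous_snd _ _).
  + exact: all_derivable_snd (d1 k).
  + by rewrite (derive1n_snd n (d1 k)) (derive1n_fst n (d k)).
- apply: (smooth_proj _ (fun v => v.2.1)) => [|k|n k t].
  + exact: continuousT_comp (@continuous_snd _ _) (@continuous_fst _ _).
  + exact: all_derivable_fst (d2 k).
  + by rewrite (derive1n_fst n (d2 k)) (derive1n_snd n (d k)).
- apply: (smooth_proj _ (fun v => v.2.2)) => [|k|n k t].
  + exact: continuousT_comp (@continuous_snd _ _) (@continuous_snd _ _).
  + exact: all_derivable_snd (d2 k).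
  + by rewrite (derive1n_snd n (d2 k)) (derive1n_snd n (d k)).
Qed.

Lemma derive1_fst (U W : normedModType R) (f : R -> U * W) t :
  all_derivable f -> (derive1 f t).1 = derive1 (fun t => (f t).1) t.
Proof. by move=> df; have := congr1 (fun h => h t) (derive1n_fst 1 df). Qed.

Lemma derive1_snd (U W : normedModType R) (f : R -> U * W) t :
  all_derivable f -> (derive1 f t).2 = derive1 (fun t => (f t).2) t.
Proof. by move=> df; have := congr1 (fun h => h t) (derive1n_snd 1 df). Qed.

Lemma curve_velE (f : torus_curve R) t : curve_vel f t =
  ((angular (sval f) t).1.1 * derive1 (fun t => (angular (sval f) t).1.2) t -
   (angular (sval f) t).1.2 * derive1 (fun t => (angular (sval f) t).1.1) t,
   (angular (sval f) t).2.1 * derive1 (fun t => (angular (sval f) t).2.2) t -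
   (angular (sval f) t).2.2 * derive1 (fun t => (angular (sval f) t).2.1) t).
Proof.
have d : all_derivable (angular (sval f)) by exact: curve_all_derivable.
have d1 := all_derivable_fst d; have d2 := all_derivable_snd d.
rewrite /curve_vel /cross (derive1_fst t d) (derive1_snd t d).
by rewrite (derive1_fst t d1) (derive1_snd t d1) (derive1_fst t d2) (derive1_snd t d2).
Qed.

Lemma curve_vel_smooth g : continuous g ->
  smooth_family (fun k t => (curve_vel (g k) t).1) /\
  smooth_family (fun k t => (curve_vel (g k) t).2).
Proof.
move=> /curve_family_smooth[s11 s12 s21 s22]; split.
- under eq_fun do under eq_fun do rewrite curve_velE.
  by apply: smoothB; apply: smoothM => //; exact: smooth_derive.
- under eq_fun do under eq_fun do rewrite curve_velE.
  by apply: smoothB; apply: smoothM => //; exact: smooth_derive.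
Qed.

End curve_families.

(** * Multiplying a curve by exp(i e) in the torus *)

Section twist.
Context {R : realType}.
Context (xi : torus_curve R).
Local Notation V := ((R * R) * (R * R))%type.

Definition twisted (a : R * R) (t : R) : V :=
  (rotation a.1 (angular (sval xi) t).1, rotation a.2 (angular (sval xi) t).2).

Lemma is_derive_rotation (a : R -> R * R) (e : R -> R) da de (t : R) :
  is_derive t 1 a da -> is_derive t 1 e de ->
  is_derive t 1 (fun u => rotation (e u) (a u))
    ((rotation (e t) da).1 - de * (rotation (e t) (a t)).2,
     (rotation (e t) da).2 + de * (rotation (e t) (a t)).1).
Proof.
move=> d ed; have d1 := is_derive1_fst d; have d2 := is_derive1_snd d.
have cd := is_derive1_comp (is_derive_cos (e t)) ed.
have sd := is_derive1_comp (is_derive_sin (e t)) ed.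
apply: is_derive1_pair.
- apply: (is_derive_eq (is_deriveB (is_deriveM d1 cd) (is_deriveM d2 sd))).
  by rewrite /rotation /GRing.scale /=; ring.
- apply: (is_derive_eq (is_deriveD (is_deriveM d1 sd) (is_deriveM d2 cd))).
  by rewrite /rotation /GRing.scale /=; ring.
Qed.

(** A common rotation preserves the cross product, and the additional term is [de] times the quarter
    turn of a unit vector. Hence velocities add when curves are multiplied in the torus. *)
Lemma cross_rotation_derive (a da : R * R) (e de : R) : dot a a = 1 ->
  cross (rotation e a) ((rotation e da).1 - de * (rotation e a).2, (rotation e da).2 + de * (rotation e a).1) =
  cross a da + de.
Proof.
move=> a1.
transitivity ((cross a da + de * dot a a) * (cos e ^+ 2 + sin e ^+ 2)).
  by rewrite /cross /dot /rotation /=; ring.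
by rewrite a1 cos2Dsin2 !mulr1.
Qed.

Lemma derive1_twisted (e1 e2 : R -> R) (t : R) :
  derivable e1 t 1 -> derivable e2 t 1 ->
  derive1 (fun u => twisted (e1 u, e2 u) u) t =
  (((rotation (e1 t) (derive1 (angular (sval xi)) t).1).1 -
      derive1 e1 t * (rotation (e1 t) (angular (sval xi) t).1).2,
    (rotation (e1 t) (derive1 (angular (sval xi)) t).1).2 +
      derive1 e1 t * (rotation (e1 t) (angular (sval xi) t).1).1),
   ((rotation (e2 t) (derive1 (angular (sval xi)) t).2).1 -
      derive1 e2 t * (rotation (e2 t) (angular (sval xi) t).2).2,
    (rotation (e2 t) (derive1 (angular (sval xi)) t).2).2 +
      derive1 e2 t * (rotation (e2 t) (angular (sval xi) t).2).1)).
Proof.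
move=> /derivableP d1 /derivableP d2.
have d : is_derive t 1 (angular (sval xi)) (derive1 (angular (sval xi)) t).
  by rewrite derive1E; apply: derivableP; exact: (@curve_all_derivable _ xi 0 t).
rewrite -!derive1E in d1 d2.
have r1 := is_derive_rotation (is_derive1_fst d) d1.
have r2 := is_derive_rotation (is_derive1_snd d) d2.
by rewrite [LHS]derive1E; case: (is_derive1_pair r1 r2).
Qed.

Lemma curve_vel_twisted (c : torus_curve R) (e1 e2 : R -> R) t :
  (forall t, angular (sval c) t = twisted (e1 t, e2 t) t) ->
  derivable e1 t 1 -> derivable e2 t 1 ->
  curve_vel c t = curve_vel xi t + (derive1 e1 t, derive1 e2 t).
Proof.
move=> ce d1 d2; have [n1 n2] := angular_norm1 (sval xi) t.
rewrite /curve_vel.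
have -> : angular (sval c) = fun u => twisted (e1 u, e2 u) u by apply/funext.
rewrite derive1_twisted// [LHS](_ : _ = (cross (angular (sval xi) t).1
    (derive1 (angular (sval xi)) t).1 + derive1 e1 t,
  cross (angular (sval xi) t).2 (derive1 (angular (sval xi)) t).2 + derive1 e2 t))//.
by apply: f_equal2; exact: cross_rotation_derive.
Qed.

Lemma rotate_circle_subproof (a : R) (z : circle R) :
  rotation a (sval z) \in [set z : R * R | z.1 ^+ 2 + z.2 ^+ 2 = 1].
Proof.
rewrite inE /=; have := svalP z; rewrite inE /= => z1.
by rewrite [LHS](dot_rotation a (sval z) (sval z)).
Qed.

Definition rotate_circle (a : R) (z : circle R) : circle R :=
  exist (fun z => z \in [set z : R * R | z.1 ^+ 2 + z.2 ^+ 2 = 1]) _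
    (rotate_circle_subproof a z).

Lemma twisted_smooth (K : topologicalType) (e1 e2 : K -> R -> R) :
  smooth_family e1 -> smooth_family e2 ->
  [/\ smooth_family (fun k t => (twisted (e1 k t, e2 k t) t).1.1),
      smooth_family (fun k t => (twisted (e1 k t, e2 k t) t).1.2),
      smooth_family (fun k t => (twisted (e1 k t, e2 k t) t).2.1) &
      smooth_family (fun k t => (twisted (e1 k t, e2 k t) t).2.2)].
Proof.
move=> s1 s2; have [a11 a12 a21 a22] := @curve_family_smooth R K (fun=> xi) (@cst_continuous _ _ _).
by split; [apply: smoothB|apply: smoothD|apply: smoothB|apply: smoothD];
  apply: smoothM => //; do ?[exact: smooth_cos|exact: smooth_sin].
Qed.

Lemma twisted_all_derivable (K : topologicalType) (e1 e2 : K -> R -> R) k :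
  smooth_family e1 -> smooth_family e2 ->
  all_derivable (fun t => twisted (e1 k t, e2 k t) t).
Proof.
move=> s1 s2; have [t11 t12 t21 t22] := twisted_smooth s1 s2.
by apply: all_derivable_pair; apply: all_derivable_pair;
  exact: (@smooth_all_derivable _ _ (fun k t => _) k).
Qed.

(** The map on the circle is written with a chosen argument of each point; periodicity of [e1] and
    [e2] removes the dependence on the choice. If the derivative vanished, so would its cross
    products with the position, which are the coordinates of the velocity. *)
Lemma twist_exists (e1 e2 : R -> R) :
  all_derivable e1 -> all_derivable e2 ->
  (forall t, e1 (t + pi *+ 2) = e1 t) -> (forall t, e2 (t + pi *+ 2) = e2 t) ->
  (forall t, curve_vel xi t + (derive1 e1 t, derive1 e2 t) != 0) ->
  exists c : torus_curve R, forall t, angular (sval c) t = twisted (e1 t, e2 t) t.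
Proof.
move=> s1 s2 p1 p2 e0.
pose arg z := projT1 (cid (@circle_point_surj R z)).
have argE z : circle_point (arg z) = z by rewrite /arg; case: cid.
pose f z : torus R := (rotate_circle (e1 (arg z)) (sval xi z).1,
  rotate_circle (e2 (arg z)) (sval xi z).2).
have fE t : angular f t = twisted (e1 t, e2 t) t.
  have [k tk] := circle_point_eq (argE (circle_point t)).
  by rewrite /angular /f /torus_val /= tk !periodic_int.
have fF : angular f = fun t => twisted (e1 t, e2 t) t by apply/funext.
have sf : smooth f.
  have := @twisted_all_derivable R (fun=> e1) (fun=> e2) 0
    (all_derivable_smooth s1) (all_derivable_smooth s2).
  by rewrite -fF.
suff im : smooth_immersion f by exists (exist _ f im).
split => // t; apply/eqP => ft0.
move: ft0; rewrite fF (derive1_twisted (s1 0 t) (s2 0 t)).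
move=> [z1 z2 z3 z4]; have := e0 t; apply/negP; rewrite negbK; apply/eqP.
have [n1 n2] := angular_norm1 (sval xi) t.
have h1 : cross (angular (sval xi) t).1 (derive1 (angular (sval xi)) t).1 +
    derive1 e1 t = 0.
  by rewrite -(cross_rotation_derive _ (e1 t) _ n1) z1 z2 /cross /= !mulr0 subrr.
have h2 : cross (angular (sval xi) t).2 (derive1 (angular (sval xi)) t).2 +
    derive1 e2 t = 0.
  by rewrite -(cross_rotation_derive _ (e2 t) _ n2) z3 z4 /cross /= !mulr0 subrr.
exact: (f_equal2 pair h1 h2).
Qed.

(** The curves are chosen separately for each parameter, but their angular functions, and with them
    all derivatives, are prescribed by jointly continuous formulas. *)
Lemma twist_family (K : topologicalType) (e1 e2 : K -> R -> R) :
  smooth_family e1 -> smooth_family e2 ->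
  (forall k t, e1 k (t + pi *+ 2) = e1 k t) ->
  (forall k t, e2 k (t + pi *+ 2) = e2 k t) ->
  (forall k t, curve_vel xi t + (derive1 (e1 k) t, derive1 (e2 k) t) != 0) ->
  exists2 g : K -> torus_curve R, continuous g &
    forall k t, angular (sval (g k)) t = twisted (e1 k t, e2 k t) t.
Proof.
move=> s1 s2 p1 p2 e0.
have /choice[g gE] : forall k, exists c : torus_curve R,
    forall t, angular (sval c) t = twisted (e1 k t, e2 k t) t.
  by move=> k; apply: twist_exists => //; exact: smooth_all_derivable.
exists g => //; apply: torus_curve_continuous => n.
have [t11 t12 t21 t22] := twisted_smooth s1 s2.
rewrite (_ : (fun kt => _) = (fun kt : K * R =>
  ((derive1n n (fun t => (twisted (e1 kt.1 t, e2 kt.1 t) t).1.1) kt.2,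
    derive1n n (fun t => (twisted (e1 kt.1 t, e2 kt.1 t) t).1.2) kt.2),
   (derive1n n (fun t => (twisted (e1 kt.1 t, e2 kt.1 t) t).2.1) kt.2,
    derive1n n (fun t => (twisted (e1 kt.1 t, e2 kt.1 t) t).2.2) kt.2)))).
  apply: continuousT_pair; apply: continuousT_pair.
  - exact: smooth_continuous (smooth_derive1n n t11).
  - exact: smooth_continuous (smooth_derive1n n t12).
  - exact: smooth_continuous (smooth_derive1n n t21).
  - exact: smooth_continuous (smooth_derive1n n t22).
apply/funext => -[k t] /=; rewrite (_ : angular (sval (g k)) =
  fun t => twisted (e1 k t, e2 k t) t); last by apply/funext.
have d : all_derivable (fun t => twisted (e1 k t, e2 k t) t) by exact: twisted_all_derivable.
have d1 := all_derivable_fst d; have d2 := all_derivable_snd d.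
rewrite (derive1n_fst n d1) (derive1n_snd n d1) (derive1n_fst n d2).
by rewrite (derive1n_snd n d2) (derive1n_fst n d) (derive1n_snd n d) -!surjective_pairing.
Qed.

End twist.

(** * Fast perturbations *)

Section periodic_bounds.
Context {R : realType} {K : topologicalType}.
Context (compactK : compact [set: K]).

Lemma periodic_bounded (f : K -> R -> R) :
  continuous (fun kt : K * R => f kt.1 kt.2) ->
  (forall k t, f k (t + pi *+ 2) = f k t) ->
  exists2 C, 0 < C & forall k t, f k t <= C.
Proof.
move=> cf pf.
have : compact ((fun kt : K * R => f kt.1 kt.2) @` ([set: K] `*` `[0, pi *+ 2])).
  apply: continuous_compact; first exact: continuous_subspaceT.
  exact: compact_setX compactK (@segment_compact _ _ _).
move=> /compact_bounded[M [_ hM]]; exists (`|M| + 1).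
  by rewrite ltr_wpDl.
move=> k t; have [t' tI <-] := periodic_reduce (pf k) t.
apply: le_trans (ler_norm _) _; apply: hM.
  by rewrite (le_lt_trans (ler_norm _))// ltrDl.
by exists (k, t').
Qed.

Lemma periodic_lower_bound (f : K -> R -> R) :
  continuous (fun kt : K * R => f kt.1 kt.2) ->
  (forall k t, f k (t + pi *+ 2) = f k t) -> (forall k t, 0 < f k t) ->
  exists2 c, 0 < c & forall k t, c <= f k t.
Proof.
move=> cf pf f0.
have [|k t|C C0 hC] := @periodic_bounded (fun k t => (f k t)^-1).
- by move=> kt; apply: continuousV; [rewrite gt_eqF|exact: cf].
- by rewrite pf.
- exists C^-1; first by rewrite invr_gt0.
  move=> k t; have := hC k t.
  by rewrite -[f k t in X in _ -> X]invrK lef_pV2 ?posrE ?invr_gt0.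
Qed.

End periodic_bounds.

Section wiggle.
Context {R : realType} {K : topologicalType} (xi : torus_curve R).
Local Notation I := (unit_itv R).

Lemma curve_vel_periodic t : curve_vel xi (t + pi *+ 2) = curve_vel xi t.
Proof.
rewrite /curve_vel angular_periodic derive1_periodic// => u.
exact: angular_periodic.
Qed.

(* With u = sin x this is X + M kappa p f(x), and |f|^2 >= 7/16. *)
Lemma wiggle_neq0 (X p : R * R) (M kappa u : R) :
  0 < dot p p -> 0 <= kappa -> 0 < M ->
  dot X X < M ^+ 2 * dot p p * (7 / 16) -> kappa = 1 \/ X = p ->
  0 < (X.1 + M * kappa * (p.1 * (1 - 2 * u ^+ 2) - p.2 * u)) ^+ 2 +
      (X.2 + M * kappa * (p.1 * u + p.2 * (1 - 2 * u ^+ 2))) ^+ 2.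
Proof.
case: X => X1 X2; case: p => p1 p2; rewrite /dot /= => p0 k0 M0 Mbig hor.
set a := X1 + _; set b := X2 + _.
rewrite lt0r addr_ge0 ?sqr_ge0// andbT paddr_eq0 ?sqr_ge0// !sqrf_eq0.
apply/negP => /andP[/eqP a0 /eqP b0].
(* Completing the square in u^2 gives the constant 7/16, reached at u^2 = 3/8. *)
have f0 : 7 / 16 <= (1 - 2 * u ^+ 2) ^+ 2 + u ^+ 2.
  have -> : (1 - 2 * u ^+ 2) ^+ 2 + u ^+ 2 = (2 * u ^+ 2 - 3 / 4) ^+ 2 + 7 / 16 :> R.
    by field.
  by rewrite lerDr sqr_ge0.
case: hor => [k1|[X1p X2p]].
  have : X1 * X1 + X2 * X2 =
      M ^+ 2 * (p1 * p1 + p2 * p2) * ((1 - 2 * u ^+ 2) ^+ 2 + u ^+ 2).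
    have -> : X1 = - (M * (p1 * (1 - 2 * u ^+ 2) - p2 * u)).
      by move: a0; rewrite /a k1 mulr1 => /eqP; rewrite addr_eq0 => /eqP.
    have -> : X2 = - (M * (p1 * u + p2 * (1 - 2 * u ^+ 2))).
      by move: b0; rewrite /b k1 mulr1 => /eqP; rewrite addr_eq0 => /eqP.
    by ring.
  apply/eqP; rewrite lt_eqF//; apply: lt_le_trans Mbig _.
  by rewrite ler_wpM2l// mulr_ge0 ?sqr_ge0// ltW.
(* When X = p, the vector is p (1 + M kappa f). The imaginary part of the second factor is M kappa
   u; if it vanishes, the real part is 1 + M kappa > 0. *)
have : (p1 * p1 + p2 * p2) * ((1 + M * kappa * (1 - 2 * u ^+ 2)) ^+ 2 +
    (M * kappa * u) ^+ 2) = 0.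
  transitivity (a ^+ 2 + b ^+ 2); first by rewrite /a /b X1p X2p; ring.
  by rewrite a0 b0 expr0n addr0.
move/eqP; rewrite mulf_eq0 gt_eqF//= paddr_eq0 ?sqr_ge0// !sqrf_eq0.
move=> /andP[/eqP e1 /eqP e2].
have : 1 + M * kappa = 0.
  rewrite -e1; transitivity (1 + M * kappa - 2 * u * (M * kappa * u)); last by ring.
  by rewrite e2 mulr0 subr0.
by apply/eqP; rewrite gt_eqF// ltr_wpDr// mulr_ge0// ltW.
Qed.

(* On the compact parameter space K, the curves xi * exp(i e_k) are perturbed
   with amplitude M kappa along the field p.  The hypothesis on kappa says that
   away from full amplitude p has to be the velocity itself. *)
Lemma wiggle_family (e1 e2 p1 p2 : K -> R -> R) (kappa : K -> R) (delta : R) :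
  compact [set: K] -> 0 < delta ->
  smooth_family e1 -> smooth_family e2 -> smooth_family p1 -> smooth_family p2 ->
  (forall k t, e1 k (t + pi *+ 2) = e1 k t) ->
  (forall k t, e2 k (t + pi *+ 2) = e2 k t) ->
  (forall k t, p1 k (t + pi *+ 2) = p1 k t) ->
  (forall k t, p2 k (t + pi *+ 2) = p2 k t) ->
  (forall k t, 0 < dot (p1 k t, p2 k t) (p1 k t, p2 k t)) ->
  continuous kappa -> (forall k, 0 <= kappa k <= 1) ->
  (forall k t, kappa k = 1 \/
    curve_vel xi t + (derive1 (e1 k) t, derive1 (e2 k) t) = (p1 k t, p2 k t)) ->
  exists (g : K -> torus_curve R) (f1 f2 : K -> R -> R) (M : R),
  [/\ continuous g,
      smooth_family f1 /\ smooth_family f2,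
      forall k t, angular (sval (g k)) t = twisted xi (f1 k t, f2 k t) t,
      forall k, kappa k = 0 -> forall t, f1 k t = e1 k t /\ f2 k t = e2 k t &
      2 <= M /\ forall k, exists r : R * R, dot r r <= delta /\
        curve_vel (g k) 0 = curve_vel xi 0 + (derive1 (e1 k) 0, derive1 (e2 k) 0) +
          (M * kappa k) *: (p1 k 0, p2 k 0) + r].
Proof.
move=> cK d0 se1 se2 sp1 sp2 pe1 pe2 pp1 pp2 P0 ck k01 alt.
pose X k t : R * R := curve_vel xi t + (derive1 (e1 k) t, derive1 (e2 k) t).
have [sv1 sv2] := @curve_vel_smooth R K (fun=> xi) (@cst_continuous _ _ _).
have sX1 : smooth_family (fun k t => (X k t).1) by exact: smoothD sv1 (smooth_derive se1).
have sX2 : smooth_family (fun k t => (X k t).2) by exact: smoothD sv2 (smooth_derive se2).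
have pX k t : X k (t + pi *+ 2) = X k t.
  by rewrite /X curve_vel_periodic (derive1_periodic (pe1 k)) (derive1_periodic (pe2 k)).
have [C C0 hC] : exists2 C, 0 < C & forall k t, dot (X k t) (X k t) <= C.
  apply: (periodic_bounded cK); last by move=> k t; rewrite pX.
  exact: smooth_continuous (smoothD (smoothM sX1 sX1) (smoothM sX2 sX2)).
have [c c0 hc] : exists2 c, 0 < c & forall k t, c <= dot (p1 k t, p2 k t) (p1 k t, p2 k t).
  apply: (periodic_lower_bound cK) => //; last by move=> k t; rewrite pp1 pp2.
  exact: smooth_continuous (smoothD (smoothM sp1 sp1) (smoothM sp2 sp2)).
(* The fraction gives M c 7/16 > C, and M^2 >= M then yields domination. The summand 2 makes this
   strict and provides M >= 2, which [loop_with_degrees] uses against a cosine equal to -1. *)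
pose M := 2 + 16 * C / (7 * c).
have M0 : 2 <= M by rewrite lerDl divr_ge0// mulr_ge0// ltW.
have Mbig k t : dot (X k t) (X k t) <
    M ^+ 2 * dot (p1 k t, p2 k t) (p1 k t, p2 k t) * (7 / 16).
  apply: le_lt_trans (hC k t) _; apply: (@lt_le_trans _ _ (M * c * (7 / 16))).
    have -> : M * c * (7 / 16) = C + 2 * c * (7 / 16).
      by rewrite /M; field; rewrite gt_eqF.
    by rewrite ltrDl !mulr_gt0.
  rewrite ler_pM2r// ler_pM ?(ltW c0)//; first by apply: le_trans M0.
  by rewrite expr2 ler_peMl//; lra.
(* sin (N t) is replaced with an independent parameter in [-1, 1], so that the
   lower bound c' below does not depend on N. *)
pose U (w : I) := 2 * itv_val w - 1.
have cU : continuous U by apply: continuous_affine; exact: itv_val_continuous.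
pose W1 (kw : K * I) t := (X kw.1 t).1 + (M * kappa kw.1) *
  (p1 kw.1 t * (1 - 2 * U kw.2 ^+ 2) - p2 kw.1 t * U kw.2).
pose W2 (kw : K * I) t := (X kw.1 t).2 + (M * kappa kw.1) *
  (p1 kw.1 t * U kw.2 + p2 kw.1 t * (1 - 2 * U kw.2 ^+ 2)).
have cMk : continuous (fun k => M * kappa k).
  by move=> k; apply: (@continuousM R K (cst M) kappa); [exact: cst_continuous|exact: ck].
have sMk : smooth_family (fun (kw : K * I) (_ : R) => M * kappa kw.1).
  exact: smooth_cst (continuousT_comp (@continuous_fst K I) cMk).
have sU : smooth_family (fun (kw : K * I) (_ : R) => U kw.2).
  exact: smooth_cst (continuousT_comp (@continuous_snd K I) cU).
have sU2 : smooth_family (fun (kw : K * I) (_ : R) => 1 - 2 * U kw.2 ^+ 2).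
  have s1 (a : R) : smooth_family (fun (kw : K * I) (_ : R) => a).
    exact/smooth_cst/cst_continuous.
  exact: smoothB (s1 1) (smoothM (s1 2) (smoothM sU sU)).
have sf (f : K -> R -> R) : smooth_family f -> smooth_family (fun kw : K * I => f kw.1).
  by apply: smooth_comp; exact: continuous_fst.
have sW1 : smooth_family W1.
  apply: smoothD; first exact: sf sX1.
  by apply: smoothM => //; apply: smoothB; apply: smoothM => //; exact: sf.
have sW2 : smooth_family W2.
  apply: smoothD; first exact: sf sX2.
  by apply: smoothM => //; apply: smoothD; apply: smoothM => //; exact: sf.
have [c' c'0 hc'] : exists2 c', 0 < c' & forall kw t, c' <= W1 kw t ^+ 2 + W2 kw t ^+ 2.
  apply: periodic_lower_bound.
  - by rewrite -setXTT; exact: compact_setX cK compact_itv_setT.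
  - exact: smooth_continuous (smoothD (smoothM sW1 sW1) (smoothM sW2 sW2)).
  - by move=> kw t; rewrite /W1 /W2 pX pp1 pp2.
  - move=> kw t; have /andP[k0 _] := k01 kw.1.
    have := @wiggle_neq0 (X kw.1 t) (p1 kw.1 t, p2 kw.1 t) M (kappa kw.1) (U kw.2)
      (P0 _ _) k0 _ (Mbig _ _) (alt _ _).
    by apply; lra.
have [D D0 hD] : exists2 D, 0 < D &
    forall k t, derive1 (p1 k) t ^+ 2 + derive1 (p2 k) t ^+ 2 <= D.
  apply: (periodic_bounded cK).
  - have sd1 := smooth_derive sp1; have sd2 := smooth_derive sp2.
    exact: smooth_continuous (smoothD (smoothM sd1 sd1) (smoothM sd2 sd2)).
  - by move=> k t; rewrite (derive1_periodic (pp1 k)) (derive1_periodic (pp2 k)).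
(* The squared error must stay below the prescribed [delta] and strictly below the lower bound c' of
   |W|^2. *)
pose d := Num.min delta (c' / 2).
have dpos : 0 < d by rewrite lt_min d0 divr_gt0.
(* The squared error is (M kappa / N)^2 |p'|^2 |g|^2, at most 2 M^2 D / N, because |g|^2 <= 2 and
   N^2 >= N. *)
pose N := (Num.truncn (2 * M ^+ 2 * D / d)).+1.
have Nbig : 2 * M ^+ 2 * D / d < N%:R by exact: truncnS_gt.
have N1 : 1 <= N%:R :> R by rewrite ler1n.
have N0 : N%:R != 0 :> R by rewrite gt_eqF// (lt_le_trans ltr01).
(* Real and imaginary parts of g(N t); [f1] and [f2] add (M kappa / N) p g(N t) as a complex
   product, and [r1], [r2] collect the terms in which the derivative falls on p. *)
pose g1 (t : R) := sin (N%:R * t) * cos (N%:R * t).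
pose g2 (t : R) := - cos (N%:R * t).
pose f1 k t := e1 k t + (M * kappa k / N%:R) * (p1 k t * g1 t - p2 k t * g2 t).
pose f2 k t := e2 k t + (M * kappa k / N%:R) * (p1 k t * g2 t + p2 k t * g1 t).
pose r1 k t := (M * kappa k / N%:R) * (derive1 (p1 k) t * g1 t - derive1 (p2 k) t * g2 t).
pose r2 k t := (M * kappa k / N%:R) * (derive1 (p1 k) t * g2 t + derive1 (p2 k) t * g1 t).
have rd k (t : R) : r1 k t ^+ 2 + r2 k t ^+ 2 <= d.
  have -> : r1 k t ^+ 2 + r2 k t ^+ 2 = (M ^+ 2 * kappa k ^+ 2 / N%:R ^+ 2) *
      (derive1 (p1 k) t ^+ 2 + derive1 (p2 k) t ^+ 2) * (g1 t ^+ 2 + g2 t ^+ 2).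
    by rewrite /r1 /r2; field.
  have -> : d = (M ^+ 2 * (d * N%:R / (2 * M ^+ 2))) / N%:R * 2.
    by field; rewrite N0 gt_eqF//; lra.
  have /andP[k0 k1] := k01 k.
  have M20 : 0 < M ^+ 2 by rewrite exprn_gt0//; lra.
  have kk : kappa k ^+ 2 <= 1 by rewrite expr_le1.
  have A0 : 0 <= M ^+ 2 * kappa k ^+ 2 / N%:R ^+ 2.
    by rewrite divr_ge0 ?sqr_ge0// -exprMn sqr_ge0.
  have A1 : M ^+ 2 * kappa k ^+ 2 / N%:R ^+ 2 <= M ^+ 2 / N%:R.
    rewrite ler_pM ?invr_ge0 ?sqr_ge0//; first by rewrite -exprMn sqr_ge0.
      by rewrite ler_piMr ?sqr_ge0.
    rewrite lef_pV2 ?posrE ?exprn_gt0 ?(lt_le_trans ltr01 N1)//.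
    by rewrite expr2 ler_peMl// (le_trans ler01).
  have B0 : 0 <= derive1 (p1 k) t ^+ 2 + derive1 (p2 k) t ^+ 2.
    by rewrite addr_ge0 ?sqr_ge0.
  have B1 : derive1 (p1 k) t ^+ 2 + derive1 (p2 k) t ^+ 2 <= d * N%:R / (2 * M ^+ 2).
    apply: le_trans (hD k t) _; rewrite ler_pdivlMr; last by rewrite mulr_gt0.
    by move: Nbig; rewrite ltr_pdivrMr// => /ltW; rewrite mulrC [in leRHS]mulrC.
  apply: ler_pM; [exact: mulr_ge0|by rewrite addr_ge0 ?sqr_ge0| |].
    by rewrite [leRHS]mulrAC; exact: ler_pM.
  have := cos2Dsin2 (N%:R * t); have := sqr_ge0 (sin (N%:R * t)).
  have := sqr_ge0 (cos (N%:R * t)); rewrite /g1 /g2 sqrrN exprMn.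
  by move: (_ ^+ 2) (_ ^+ 2) => x y x0 y0 xy; nra.
have dN (t : R) : is_derive t 1 (fun u : R => N%:R * u) (N%:R : R).
  apply: (is_derive_eq (is_deriveM (is_derive_cst (N%:R : R) t 1) (is_derive_id t 1))).
  by rewrite /GRing.scale /= mulr0 addr0 mulr1.
have dsin (t : R) := is_derive1_comp (is_derive_sin (N%:R * t)) (dN t).
have dcos (t : R) := is_derive1_comp (is_derive_cos (N%:R * t)) (dN t).
have dg1 (t : R) : is_derive t 1 g1 (N%:R * (1 - 2 * sin (N%:R * t) ^+ 2)).
  apply: (is_derive_eq (is_deriveM (dsin t) (dcos t))); rewrite /GRing.scale /=.
  have -> : cos (N%:R * t) * (cos (N%:R * t) * N%:R) = cos (N%:R * t) ^+ 2 * N%:R.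
    by ring.
  by rewrite cos2sin2; ring.
have dg2 (t : R) : is_derive t 1 g2 (N%:R * sin (N%:R * t)).
  apply: (is_derive_eq (is_deriveN (dcos t))).
  by rewrite mulNr opprK mulrC.
have df1 k (t : R) : is_derive t 1 (f1 k) (derive1 (e1 k) t + (M * kappa k) *
    (p1 k t * (1 - 2 * sin (N%:R * t) ^+ 2) - p2 k t * sin (N%:R * t)) + r1 k t).
  have de := smooth_is_derive k t se1.
  have dp1 := smooth_is_derive k t sp1; have dp2 := smooth_is_derive k t sp2.
  apply: (is_derive_eq (is_deriveD de (is_deriveM
    (is_derive_cst (M * kappa k / N%:R) t 1)
    (is_deriveB (is_deriveM dp1 (dg1 t)) (is_deriveM dp2 (dg2 t)))))).
  by rewrite /GRing.scale /= /r1; field.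
have df2 k (t : R) : is_derive t 1 (f2 k) (derive1 (e2 k) t + (M * kappa k) *
    (p1 k t * sin (N%:R * t) + p2 k t * (1 - 2 * sin (N%:R * t) ^+ 2)) + r2 k t).
  have de := smooth_is_derive k t se2.
  have dp1 := smooth_is_derive k t sp1; have dp2 := smooth_is_derive k t sp2.
  apply: (is_derive_eq (is_deriveD de (is_deriveM
    (is_derive_cst (M * kappa k / N%:R) t 1)
    (is_deriveD (is_deriveM dp1 (dg2 t)) (is_deriveM dp2 (dg1 t)))))).
  by rewrite /GRing.scale /= /r2; field.
have sNt : smooth_family (fun (_ : K) (t : R) => (N%:R : R) * t).
  have sc (a : R) : smooth_family (fun (_ : K) (_ : R) => a).
    exact/smooth_cst/cst_continuous.
  exact: (smoothM (sc N%:R) (@smooth_id R K)).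
have sg1 : smooth_family (fun (k : K) => g1).
  exact: (smoothM (smooth_sin sNt) (smooth_cos sNt)).
have sg2 : smooth_family (fun (k : K) => g2) by exact: (smoothN (smooth_cos sNt)).
have sMN : smooth_family (fun k (_ : R) => M * kappa k / N%:R).
  apply: smooth_cst => k.
  by apply: (@continuousM R K (fun k => M * kappa k) (cst N%:R^-1));
    [exact: cMk|exact: cst_continuous].
have sf1 : smooth_family f1.
  by apply: smoothD => //; apply: smoothM => //; apply: smoothB; exact: smoothM.
have sf2 : smooth_family f2.
  by apply: smoothD => //; apply: smoothM => //; apply: smoothD; exact: smoothM.
have pN (t : R) : cos (N%:R * (t + pi *+ 2)) = cos (N%:R * t) /\
    sin (N%:R * (t + pi *+ 2)) = sin (N%:R * t).
  rewrite mulrDr [N%:R * (pi *+ 2)]mulrC.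
  have := periodic_int (@cosD2pi R) (N%:R * t) N.
  by have := periodic_int (@sinD2pi R) (N%:R * t) N.
have pf1 k t : f1 k (t + pi *+ 2) = f1 k t.
  by have [c1 s1] := pN t; rewrite /f1 /g1 /g2 c1 s1 pe1 pp1 pp2.
have pf2 k t : f2 k (t + pi *+ 2) = f2 k t.
  by have [c1 s1] := pN t; rewrite /f2 /g1 /g2 c1 s1 pe2 pp1 pp2.
(* The free parameter is specialized to w = (sin (N t) + 1) / 2, for which U w = sin (N t). *)
have velE k (t : R) : curve_vel xi t + (derive1 (f1 k) t, derive1 (f2 k) t) =
    (W1 (k, clamp ((sin (N%:R * t) + 1) / 2)) t + r1 k t,
     W2 (k, clamp ((sin (N%:R * t) + 1) / 2)) t + r2 k t).
  have -> : derive1 (f1 k) t = _ := derive1_unique (df1 k t).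
  have -> : derive1 (f2 k) t = _ := derive1_unique (df2 k t).
  rewrite /W1 /W2 /U /= clampK; last first.
    by have := sin_geN1 (N%:R * t); have := sin_le1 (N%:R * t); lra.
  rewrite [2 * (_ / 2)]mulrC divfK ?pnatr_eq0// addrK.
  by apply: (f_equal2 pair); rewrite /X /=; ring.
have f0 k t : curve_vel xi t + (derive1 (f1 k) t, derive1 (f2 k) t) != 0.
  rewrite velE; set kw := (k, _); apply/eqP => -[z1 z2].
  have := hc' kw t; have := rd k t.
  have -> : r1 k t = - W1 kw t by move/eqP: z1; rewrite addrC addr_eq0 => /eqP.
  have -> : r2 k t = - W2 kw t by move/eqP: z2; rewrite addrC addr_eq0 => /eqP.
  have : d <= c' / 2 by rewrite ge_min lexx orbT.
  rewrite !sqrrN => h1 h2 h3; have := le_trans h3 (le_trans h2 h1); lra.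
have [g cg gE] := twist_family sf1 sf2 pf1 pf2 f0.
exists g, f1, f2, M; split => //.
- by move=> k k0 t; rewrite /f1 /f2 k0 mulr0 !mul0r !addr0.
- split => // k; exists (r1 k 0, r2 k 0); split.
    by apply: le_trans (rd k 0) _; rewrite ge_min lexx.
  rewrite (curve_vel_twisted (gE k)); last 2 first.
  + by case: (df1 k 0).
  + by case: (df2 k 0).
  (* At t = 0 the sine vanishes and f(0) = 1, so the fast term is M kappa p. *)
  rewrite velE /W1 /W2 mulr0 sin0 add0r /U clampK; last by lra.
  have -> : 2 * (1 / 2) - 1 = 0 :> R by field.
  by apply: (f_equal2 pair); rewrite /X /= expr0n /= !mulr0 !subr0 !mulr1 ?add0r.
Qed.

End wiggle.

(** * Loops of curves *)

Section periodic_lift.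
Context {R : realType}.
Local Notation I := (unit_itv R).

Lemma dir_unit e (a b : R * R) : dot a a = 1 -> dot b b = 1 -> dir e a b ->
  b = rotation e a.
Proof.
move=> a1 b1 [r r0 br]; have : r ^+ 2 = 1.
  rewrite -b1 br -[LHS]mulr1 -a1 -(dot_rotation e) /dot /=.
  by ring.
move=> /eqP; rewrite sqrf_eq1 => /orP[/eqP r1|/eqP r1]; last by rewrite r1 ltr0N1 in r0.
by rewrite br r1 !mul1r -surjective_pairing.
Qed.

(** Periodicity in t gives a subdivision valid for all t from the one on [0, 2pi]. Each path s -> z
    s t is closed, so the final value of its lift lies in 2pi Z; being continuous in t, it is a
    single multiple of 2pi, read off at t = 0. *)
Lemma periodic_lift (z1 z2 : I -> R -> R) :
  smooth_family z1 -> smooth_family z2 ->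
  (forall s t, z1 s (t + pi *+ 2) = z1 s t) ->
  (forall s t, z2 s (t + pi *+ 2) = z2 s t) ->
  (forall s t, (z1 s t, z2 s t) != 0) ->
  (forall t, z1 one t = z1 zero t /\ z2 one t = z2 zero t) ->
  exists (D : I -> R -> R) (k : int),
  [/\ smooth_family D, forall s t, D s (t + pi *+ 2) = D s t,
      forall t, D zero t = 0 /\ D one t = pi *+ 2 * k%:~R,
      forall s t, dir (D s t) (z1 zero t, z2 zero t) (z1 s t, z2 s t) &
      wind (fun s => (z1 s 0, z2 s 0)) k].
Proof.
move=> s1 s2 p1 p2 z0 zl.
pose z s t := (z1 s t, z2 s t).
have cz : continuous (fun st : I * R => z st.1 st.2).
  by apply: continuousT_pair; exact: smooth_continuous.
have [m m0 hm] := uniform_subdivision (@segment_compact R 0 (pi *+ 2)) cz z0.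
have zp t : z ^~ (t + pi *+ 2) = z ^~ t.
  by apply/funext => s; rewrite /z p1 p2.
have fz t : fine_subdivision m (z ^~ t).
  split=> // x x' xx'.
  have [t' t'I e] := periodic_reduce zp t.
  by have := hm x x' t' t'I xx'; rewrite -[z (clamp x) t']/((z ^~ t') _)
    -[z (clamp x') t']/((z ^~ t') _) e.
pose D s t := angle_lift m (z ^~ t) s.
have sD : smooth_family D by exact: angle_lift_smooth.
have lD t : is_lift (z ^~ t) (D^~ t).
  split; [|exact: angle_lift0|by move=> s; exact: angle_lift_dir].
  have cs : continuous (fun s : I => (s, t)).
    by apply: continuousT_pair; [move=> ?; exact: cvg_id|exact: cst_continuous].
  exact: (continuousT_comp cs (smooth_continuous sD)).
have zl' t : z one t = z zero t by have [e1 e2] := zl t; rewrite /z e1 e2.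
have Dint t : exists k : int, D one t = pi *+ 2 * k%:~R.
  exact: (is_lift_closed (z0 _ _) (zl' t) (lD t)).
have Dc t : D one t = D one 0.
  have := @integer_valued_cst R (fun x => D one (x * t)) (pi *+ 2) _ pi2_gt0.
  rewrite mul0r mul1r; apply => [|s _]; last exact: Dint.
  have cx : continuous (fun x : R => (one : I, x * t)).
    apply: continuousT_pair; first exact: cst_continuous.
    by move=> x; apply: (@continuousM R R id (cst t)); [exact: cvg_id|exact: cst_continuous].
  exact: (continuousT_comp cx (smooth_continuous sD)).
have [k Dk] := Dint 0.
exists D, k; split => //.
- by move=> s t; rewrite /D zp.
- by move=> t; split; [exact: angle_lift0|rewrite Dc].
- by move=> s t; have [_ _] := lD t; apply.
- by exists (D^~ 0); first exact: lD.
Qed.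

End periodic_lift.

Section main_lemmas.
Context {R : realType}.
Local Notation I := (unit_itv R).

Definition base1 (f : torus_curve R) : R * R := (angular (sval f) 0).1.
Definition base2 (f : torus_curve R) : R * R := (angular (sval f) 0).2.
Definition base_vel (f : torus_curve R) : R * R := curve_vel f 0.

Lemma base1_neq0 f : base1 f != 0.
Proof. by rewrite plane_neq0 /base1; case: (angular_norm1 (sval f) 0) => -> _. Qed.

Lemma base2_neq0 f : base2 f != 0.
Proof. by rewrite plane_neq0 /base2; case: (angular_norm1 (sval f) 0) => _ ->. Qed.

Lemma base_vel_neq0 f : base_vel f != 0.
Proof. exact: curve_vel_neq0. Qed.

Definition cut (x : R) : R := itv_val (clamp x).

Lemma cut_ge0 x : 0 <= cut x. Proof. exact: itv_val_ge0. Qed.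
Lemma cut_le1 x : cut x <= 1. Proof. exact: itv_val_le1. Qed.

Lemma cut_eq0 x : x <= 0 -> cut x = 0.
Proof. by move=> x0; rewrite /cut clamp_le0// -itv_zeroE itv_val_zero. Qed.

Lemma cut_eq1 x : 1 <= x -> cut x = 1.
Proof. by move=> x1; rewrite /cut clamp_ge1// -itv_oneE itv_val_one. Qed.

(** [middle] and [tent] separate motion from switching: the loop moves only on the middle third,
    where [tent] is 1, and [tent] goes to 0 on the outer thirds, where [middle] is stationary. *)
Definition middle (s : I) : I := clamp (3 * itv_val s - 1).
Definition tent (s : I) : R := cut (3 * itv_val s) * cut (3 - 3 * itv_val s).

Lemma cut_continuous (T : topologicalType) (f : T -> R) :
  continuous f -> continuous (fun t => cut (f t)).
Proof.
by move=> cf; exact: (continuousT_comp (continuous_clamp_comp cf) (@itv_val_continuous R)).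
Qed.

Lemma middle_continuous : continuous middle.
Proof. exact/continuous_clamp_comp/continuous_affine/itv_val_continuous. Qed.

Lemma tent_continuous : continuous tent.
Proof.
have c1 : continuous (fun s : I => cut (3 * itv_val s)).
  apply: cut_continuous => s.
  by apply: (@continuousM R I (cst 3) (@itv_val R));
    [exact: cst_continuous|exact: itv_val_continuous].
have c2 : continuous (fun s : I => cut (3 - 3 * itv_val s)).
  apply: cut_continuous.
  have := @continuous_affine R I (@itv_val R) (- 3) 3 (@itv_val_continuous R).
  by under eq_fun do rewrite mulNr addrC.
by move=> s; exact: (continuousM (c1 s) (c2 s)).
Qed.

Lemma tent_bounds s : 0 <= tent s <= 1.
Proof. by rewrite mulr_ge0 ?cut_ge0// mulr_ile1 ?cut_ge0 ?cut_le1. Qed.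

Lemma tent_zero : tent zero = 0.
Proof. by rewrite /tent itv_val_zero mulr0 cut_eq0// mul0r. Qed.

Lemma tent_one : tent one = 0.
Proof. by rewrite /tent itv_val_one mulr1 subrr mulrC cut_eq0// mul0r. Qed.

Lemma middle_zero : middle zero = zero.
Proof. by rewrite /middle itv_val_zero mulr0 clamp_le0// sub0r lerN10. Qed.

Lemma middle_one : middle one = one.
Proof. by rewrite /middle itv_val_one mulr1 clamp_ge1//; lra. Qed.

Lemma tent_middle s : [\/ tent s = 1, middle s = zero | middle s = one].
Proof.
have [s1|s1] := leP (3 * itv_val s) 1.
  by apply: Or32; rewrite /middle clamp_le0// subr_le0.
have [s2|s2] := leP 2 (3 * itv_val s).
  by apply: Or33; rewrite /middle clamp_ge1//; lra.
by apply: Or31; rewrite /tent !cut_eq1 ?mulr1//; lra.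
Qed.

Lemma rotation_int a (z : R * R) (k : int) : a = pi *+ 2 * k%:~R -> rotation a z = z.
Proof.
move=> ->; rewrite /rotation.
have := periodic_int (@cosD2pi R) 0 k; have := periodic_int (@sinD2pi R) 0 k.
rewrite !add0r sin0 cos0 => -> ->.
by rewrite !mulr1 !mulr0 subr0 add0r -surjective_pairing.
Qed.

Context (xi : torus_curve R).
Local Notation loop := {path I from xi to xi in torus_curve R}.

(** The points are unit vectors, so the positive factor in [dir] is 1 and the loop is [xi]
    multiplied by exp(i E); the winding at t = 0 determines the final value of E at all t. The
    projection [pr] covers both circle factors at once. *)
Lemma angular_lift (p : loop) (pr : (R * R) * (R * R) -> R * R) k0 :
  (pr = fst \/ pr = snd) -> wind (fun s => pr (angular (sval (p s)) 0)) k0 ->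
  exists E : I -> R -> R,
  [/\ smooth_family E, forall s t, E s (t + pi *+ 2) = E s t,
      forall t, E zero t = 0 /\ E one t = pi *+ 2 * k0%:~R &
      forall s t, pr (angular (sval (p s)) t) = rotation (E s t) (pr (angular (sval xi) t))].
Proof.
move=> hpr w.
have nrm f t : dot (pr (angular f t)) (pr (angular f t)) = 1.
  by case: (angular_norm1 f t); case: hpr => ->.
have [a11 a12 a21 a22] := curve_family_smooth (@cts_fun _ _ p).
have [s1 s2] : smooth_family (fun s t => (pr (angular (sval (p s)) t)).1) /\
    smooth_family (fun s t => (pr (angular (sval (p s)) t)).2) by case: hpr => ->.
have [||s t|t|E [k [sE pE Eb Ed Ew]]] := periodic_lift s1 s2.
- by move=> s t; rewrite angular_periodic.
- by move=> s t; rewrite angular_periodic.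
- by rewrite -surjective_pairing plane_neq0 nrm.
- by rewrite path_one path_zero.
have kk : k = k0.
  apply: (wind_unique _ Ew); first by rewrite -surjective_pairing plane_neq0 nrm.
  by under eq_fun do rewrite -surjective_pairing.
exists E; split => //; first by move=> t; rewrite -kk; exact: Eb.
move=> s t; apply: dir_unit => //.
by have := Ed s t; rewrite -!surjective_pairing path_zero.
Qed.


Lemma velocity_lift (p : loop) k0 : wind (fun s => base_vel (p s)) k0 ->
  exists D : I -> R -> R,
  [/\ smooth_family D, forall s t, D s (t + pi *+ 2) = D s t,
      forall t, D zero t = 0 /\ D one t = pi *+ 2 * k0%:~R &
      forall s t, dir (D s t) (curve_vel xi t) (curve_vel (p s) t)].
Proof.
move=> w; have [s1 s2] : smooth_family (fun s t => (curve_vel (p s) t).1) /\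
    smooth_family (fun s t => (curve_vel (p s) t).2).
  exact: curve_vel_smooth (@cts_fun _ _ p).
have [||s t|t|D [k [sD pD Db Dd Dw]]] := periodic_lift s1 s2.
- by move=> s t; rewrite curve_vel_periodic.
- by move=> s t; rewrite curve_vel_periodic.
- by rewrite -surjective_pairing curve_vel_neq0.
- by rewrite path_one path_zero.
have kk : k = k0.
  apply: (wind_unique _ Dw); first by rewrite -surjective_pairing curve_vel_neq0.
  by under eq_fun do rewrite -surjective_pairing.
exists D; split; [exact: sD|exact: pD|by move=> t; rewrite -kk; exact: Db|].
move=> s t; have d : dir (D s t)
  ((curve_vel (p zero) t).1, (curve_vel (p zero) t).2)
  ((curve_vel (p s) t).1, (curve_vel (p s) t).2) := Dd s t.
have e (c : torus_curve R) : curve_vel c t = ((curve_vel c t).1, (curve_vel c t).2).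
  by case: (curve_vel c t).
have pz : p zero = xi by exact: path_zero.
by rewrite (e xi) (e (p s)); rewrite pz in d; exact: d.
Qed.

Lemma path_loop (g : I -> torus_curve R) : continuous g -> g zero = xi -> g one = xi ->
  exists p : loop, forall s, p s = g s.
Proof. by move=> cg g0 g1; exists (mk_path cg g0 g1). Qed.

Lemma dir_rotation a (z : R * R) : dir a z (rotation a z).
Proof. by exists 1 => //; rewrite !mul1r -surjective_pairing. Qed.

Lemma twisted_int (c : torus_curve R) (a b : R) (m n : int) :
  a = pi *+ 2 * m%:~R -> b = pi *+ 2 * n%:~R ->
  forall t, twisted c (a, b) t = angular (sval c) t.
Proof.
move=> am bn t; rewrite [RHS]surjective_pairing; apply: (f_equal2 pair).
  exact: rotation_int am.
exact: rotation_int bn.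
Qed.

(** The slow part only translates [xi], m times around the first factor and n times around the
    second, so its velocity remains [v0]; the field is [v0] turned k times. Both move only where
    [tent] is 1; elsewhere the field is [v0] itself. *)
Lemma loop_with_degrees (m n k : int) : exists p : loop,
  [/\ wind (fun s => base1 (p s)) m, wind (fun s => base2 (p s)) n &
      wind (fun s => base_vel (p s)) k].
Proof.
pose T : R := pi *+ 2.
pose sg s : R := itv_val (middle s).
have csg : continuous sg.
  exact: (continuousT_comp middle_continuous (@itv_val_continuous R)).
have csc (a : R) : continuous (fun s => a * sg s).
  by move=> s; apply: (@continuousM R I (cst a) sg);
    [exact: cst_continuous|exact: csg].
have sg0 : sg zero = 0 by rewrite /sg middle_zero itv_val_zero.
have sg1 : sg one = 1 by rewrite /sg middle_one itv_val_one.
pose e1 (s : I) (_ : R) := T * m%:~R * sg s.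
pose e2 (s : I) (_ : R) := T * n%:~R * sg s.
pose al (s : I) := T * k%:~R * sg s.
pose v0 := curve_vel xi.
pose p1 s t := (rotation (al s) (v0 t)).1.
pose p2 s t := (rotation (al s) (v0 t)).2.
have se1 : smooth_family e1 by exact/smooth_cst/csc.
have se2 : smooth_family e2 by exact/smooth_cst/csc.
have sal : smooth_family (fun s (_ : R) => al s) by exact/smooth_cst/csc.
have [sv1 sv2] := @curve_vel_smooth R I (fun=> xi) (@cst_continuous _ _ _).
have sp1 : smooth_family p1.
  exact: (smoothB (smoothM sv1 (smooth_cos sal)) (smoothM sv2 (smooth_sin sal))).
have sp2 : smooth_family p2.
  exact: (smoothD (smoothM sv1 (smooth_sin sal)) (smoothM sv2 (smooth_cos sal))).
have v0p t : v0 (t + pi *+ 2) = v0 t by exact: curve_vel_periodic.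
have v0pos t : 0 < dot (v0 t) (v0 t) by rewrite -plane_neq0 curve_vel_neq0.
(* With this bound, |w|^2 - |w|^2/4 - |r|^2 >= |w|^2/2 > 0 in the estimate of [bpos]. *)
pose delta := dot (v0 0) (v0 0) / 4.
have delta0 : 0 < delta by rewrite divr_gt0.
have ppos s t : 0 < dot (p1 s t, p2 s t) (p1 s t, p2 s t).
  by rewrite /p1 /p2 -surjective_pairing dot_rotation.
have alt s t : tent s = 1 \/
    curve_vel xi t + (derive1 (e1 s) t, derive1 (e2 s) t) = (p1 s t, p2 s t).
  have base : al s = T * (k * 0)%:~R \/ al s = T * k%:~R ->
      curve_vel xi t + (derive1 (e1 s) t, derive1 (e2 s) t) = (p1 s t, p2 s t).
    move=> h; rewrite /e1 /e2 !derive1_cst addr0 /p1 /p2 -surjective_pairing.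
    by case: h => h; rewrite (rotation_int _ h).
  have [ts|ms|ms] := tent_middle s; [by left|right; apply: base..].
    by left; rewrite /al /sg ms itv_val_zero !mulr0.
  by right; rewrite /al /sg ms itv_val_one mulr1.
have [g [f1 [f2 [M [cg [sf1 sf2] gE g0 [M2 gv]]]]]] := wiggle_family
  (@compact_itv_setT R) delta0 se1 se2 sp1 sp2 (fun _ _ => erefl) (fun _ _ => erefl)
  (fun s t => congr1 (fun v => (rotation (al s) v).1) (v0p t))
  (fun s t => congr1 (fun v => (rotation (al s) v).2) (v0p t))
  ppos tent_continuous tent_bounds alt.
have f_end s (a b : int) : tent s = 0 -> sg s * m%:~R = a%:~R -> sg s * n%:~R = b%:~R ->
    [/\ forall t, f1 s t = pi *+ 2 * a%:~R, forall t, f2 s t = pi *+ 2 * b%:~R & g s = xi].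
  move=> ts sa sb.
  have h1 t : f1 s t = pi *+ 2 * a%:~R.
    by have [-> _] := g0 s ts t; rewrite /e1 -mulrA [_ * sg s]mulrC sa.
  have h2 t : f2 s t = pi *+ 2 * b%:~R.
    by have [_ ->] := g0 s ts t; rewrite /e2 -mulrA [_ * sg s]mulrC sb.
  split=> //; apply: angular_inj => t; rewrite gE.
  exact: (twisted_int xi (h1 t) (h2 t)).
have [f1z f2z gz] : [/\ forall t, f1 zero t = pi *+ 2 * 0%:~R,
    forall t, f2 zero t = pi *+ 2 * 0%:~R & g zero = xi].
  by apply: f_end; [exact: tent_zero|rewrite sg0 mul0r|rewrite sg0 mul0r].
have [f1o f2o go] : [/\ forall t, f1 one t = pi *+ 2 * m%:~R,
    forall t, f2 one t = pi *+ 2 * n%:~R & g one = xi].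
  by apply: f_end; [exact: tent_one|rewrite sg1 mul1r|rewrite sg1 mul1r].
have [p pE] := path_loop cg gz go.
have at0 (f : I -> R -> R) : smooth_family f -> continuous (fun s => f s 0).
  move=> sf; have c0 : continuous (fun s : I => (s, 0 : R)).
    by apply: continuousT_pair; [move=> ?; exact: cvg_id|exact: cst_continuous].
  exact: (continuousT_comp c0 (smooth_continuous sf)).
exists p; split.
- exists (fun s => f1 s 0); last exact: f1o.
  split; [exact: at0|by rewrite f1z mulr0|move=> s].
  rewrite !pE gz /base1 gE; exact: dir_rotation.
- exists (fun s => f2 s 0); last exact: f2o.
  split; [exact: at0|by rewrite f2z mulr0|move=> s].
  rewrite !pE gz /base2 gE; exact: dir_rotation.
have [svg1 svg2] := curve_vel_smooth cg.
have cbv : continuous (fun s => base_vel (g s)).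
  have := continuousT_pair (at0 _ svg1) (at0 _ svg2).
  by under eq_fun do rewrite -(surjective_pairing (curve_vel _ _)).
have calv : continuous (fun s => rotation (al s) (v0 0)).
  exact: (continuousT_pair (at0 _ sp1) (at0 _ sp2)).
(* The velocity at t = 0 stays within a right angle of the field, whose angle is [al]. Its lift is
   therefore [al] plus an arctangent correction that vanishes at both ends of the loop, so it turns
   k times as well. *)
have bpos s : 0 < dot (rotation (al s) (v0 0)) (base_vel (g s)).
  have [r [rd gs]] := gv s.
  set w := rotation (al s) (v0 0).
  have ww : dot w w = dot (v0 0) (v0 0) by rewrite dot_rotation.
  have X0 : curve_vel xi 0 + (derive1 (e1 s) 0, derive1 (e2 s) 0) = v0 0.
    by rewrite /e1 /e2 !derive1_cst addr0.
  rewrite /base_vel gs X0.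
  have -> : (p1 s 0, p2 s 0) = w by rewrite /p1 /p2 -surjective_pairing.
  have split_dot : dot w (v0 0 + (M * tent s) *: w + r) =
      dot w (v0 0) + M * tent s * dot w w + dot w r.
    by rewrite /dot /=; rewrite /GRing.scale /=; ring.
  rewrite split_dot.
  have wr : - (dot w w / 4 + dot r r) <= dot w r.
    rewrite lerNl -subr_ge0.
    have -> : dot w w / 4 + dot r r - - dot w r =
        (w.1 / 2 + r.1) ^+ 2 + (w.2 / 2 + r.2) ^+ 2 by rewrite /dot; field.
    by rewrite addr_ge0 ?sqr_ge0.
  (* At full amplitude M >= 2 compensates cos (al s) >= -1; elsewhere the field has made an integral
     number of turns and the cosine is 1. *)
  have wv : dot w (v0 0) + M * tent s * dot w w >= dot w w.
    have dwv : dot w (v0 0) = cos (al s) * dot w w.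
      by rewrite ww /w /dot /rotation /=; ring.
    have w0 : 0 < dot w w by rewrite ww.
    have /andP[t0 t1] := tent_bounds s.
    rewrite dwv -mulrDl ler_peMl ?(ltW w0)//.
    have cos_al (j : int) : sg s * k%:~R = j%:~R -> 1 <= cos (al s) + M * tent s.
      move=> sj; have -> : cos (al s) = 1.
        rewrite /al -mulrA [_ * sg s]mulrC sj -[X in cos X]add0r.
        by rewrite periodic_int ?cos0//; exact: cosD2pi.
      by rewrite lerDl mulr_ge0//; lra.
    have [ts|ms|ms] := tent_middle s.
    - by rewrite ts mulr1; have := cos_geN1 (al s); lra.
    - by apply: (cos_al 0); rewrite /sg ms itv_val_zero mul0r.
    - by apply: (cos_al k); rewrite /sg ms itv_val_one mul1r.
  have := v0pos 0; move: rd wr wv; rewrite /delta ww; lra.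
exists (fun s => al s + ang (rotation (al s) (v0 0)) (base_vel (g s))); last first.
  rewrite go /al sg1 mulr1 (rotation_int _ erefl).
  by rewrite /v0 /base_vel ang_id addr0.
split.
- move=> s; apply: (@continuousD R R^o I al
    (fun s => ang (rotation (al s) (v0 0)) (base_vel (g s)))); first exact: csc.
  exact: ang_continuous.
- by rewrite gz /al sg0 mulr0 rotation0 /base_vel /v0 ang_id addr0.
- move=> s; rewrite !pE gz; apply: dir_trans (dir_rotation _ _) _.
  exact: dir_ang.
Qed.

Lemma middle_homotopic (p q : loop) : (forall s, q s = p (middle s)) -> homotopic p q.
Proof.
move=> qE; apply: (@homotopic_reparam R _ _ p p q id (fun a => 3 * a - 1)) => //.
- by move=> ?; exact: cvg_id.
- exact: affine_continuous.
- move=> a; rewrite qE /middle; have [a0|a0] := ltP a 0.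
    by rewrite !loop_le0//; rewrite ?clamp_le0 -?itv_zeroE ?itv_val_zero; lra.
  have [a1|a1] := ltP 1 a; last by rewrite clampK// a0.
  by rewrite !loop_ge1//; rewrite ?clamp_ge1 -?itv_oneE ?itv_val_one; lra.
- by move=> a b [->|->] /andP[b0 b1]; [rewrite loop_le0//|rewrite loop_ge1//]; lra.
Qed.

(** When the degrees vanish, the lifts [E1], [E2] and [D] return to 0 at the end of the loop, so
    they can be scaled down to 0 with both ends held at [xi]. *)
Lemma homotopic_constant (p : loop) :
  wind (fun s => base1 (p s)) 0 -> wind (fun s => base2 (p s)) 0 ->
  wind (fun s => base_vel (p s)) 0 -> homotopic p (constant_loop xi).
Proof.
move=> w1 w2 w3.
have [E1 [sE1 pE1 bE1 aE1]] := angular_lift (or_introl erefl) w1.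
have [E2 [sE2 pE2 bE2 aE2]] := angular_lift (or_intror erefl) w2.
have [D [sD pD bD dD]] := velocity_lift w3.
have angE s t : angular (sval (p s)) t = twisted xi (E1 s t, E2 s t) t.
  by rewrite [LHS]surjective_pairing; apply: (f_equal2 pair); [exact: aE1|exact: aE2].
have velE s t : curve_vel (p s) t =
    curve_vel xi t + (derive1 (E1 s) t, derive1 (E2 s) t).
  apply: (curve_vel_twisted (angE s)).
    by case: (smooth_is_derive s t sE1).
  by case: (smooth_is_derive s t sE2).
(* The homotopy has three stages: the perturbation is switched on (kap), the
   slow part and the field are deformed to those of xi (mu), the perturbation is
   switched off.  It stays off at both ends of the loop, since the loop is
   stationary on the outer thirds of its domain, where tent is not 1. *)
pose mu (k : I * I) := cut (3 * itv_val k.1 - 1).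
pose kap (k : I * I) := tent k.2 * (cut (3 * itv_val k.1) - cut (3 * itv_val k.1 - 2)).
pose sg (k : I * I) := middle k.2.
have csg : continuous sg by exact: (continuousT_comp (@continuous_snd I I) middle_continuous).
have c1 : continuous (fun k : I * I => itv_val k.1) by exact: fst_val_continuous.
have c3 : continuous (fun k : I * I => 3 * itv_val k.1).
  by move=> k; apply: (@continuousM R (I * I)%type (cst 3) (fun k => itv_val k.1));
    [exact: cst_continuous|exact: c1].
have cmu : continuous mu by apply: cut_continuous; exact: continuous_affine.
have ckap : continuous kap.
  move=> k; apply: (@continuousM R (I * I)%type (fun k => tent k.2)).
    exact: (continuousT_comp (@continuous_snd I I) tent_continuous).
  apply: (@continuousB R R^o (I * I)%type (fun k => cut (3 * itv_val k.1))).
    exact: cut_continuous.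
  by apply: cut_continuous; exact: continuous_affine.
have kapb k : 0 <= kap k <= 1.
  have /andP[t0 t1] := tent_bounds k.2.
  have h : 0 <= cut (3 * itv_val k.1) - cut (3 * itv_val k.1 - 2) <= 1.
    have a0 := cut_ge0 (3 * itv_val k.1 - 2); have a1 := cut_le1 (3 * itv_val k.1).
    have [b|b] := leP (3 * itv_val k.1) 2.
      by rewrite [cut (_ - 2)]cut_eq0 ?subr0 ?cut_ge0//; lra.
    rewrite [cut (3 * itv_val k.1)]cut_eq1 in a1 *; last by lra.
    by have := cut_le1 (3 * itv_val k.1 - 2); lra.
  by have /andP[h0 h1] := h; rewrite mulr_ge0// mulr_ile1.
pose v0 (_ : I * I) t := curve_vel xi t.
pose v (k : I * I) t := curve_vel (p (sg k)) t.
have [sv01 sv02] : smooth_family (fun k t => (v0 k t).1) /\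
    smooth_family (fun k t => (v0 k t).2).
  exact: (@curve_vel_smooth R _ (fun=> xi) (@cst_continuous _ _ _)).
have [sv1 sv2] : smooth_family (fun k t => (v k t).1) /\
    smooth_family (fun k t => (v k t).2).
  exact: (@curve_vel_smooth R _ (fun k => p (sg k)) (continuousT_comp csg (@cts_fun _ _ p))).
pose Dk (k : I * I) t := D (sg k) t.
have sDk : smooth_family Dk by exact: smooth_comp.
have smu : smooth_family (fun k (_ : R) => mu k) by exact: smooth_cst.
have sm1 : smooth_family (fun k (_ : R) => 1 - mu k).
  by apply: (smoothB _ smu); exact/smooth_cst/cst_continuous.
(* The interpolation corrects the length: turning v back by the angle [Dk] gives only a positive
   multiple of [v0], whereas at mu = 1 the field has to equal [v0] for the perturbation to be
   switched off. *)
pose q1 k t := (1 - mu k) * (v k t).1 + mu k * (rotation (Dk k t) (v0 k t)).1.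
pose q2 k t := (1 - mu k) * (v k t).2 + mu k * (rotation (Dk k t) (v0 k t)).2.
have srotation (z1 z2 a : I * I -> R -> R) : smooth_family z1 -> smooth_family z2 ->
    smooth_family a -> smooth_family (fun k t => (rotation (a k t) (z1 k t, z2 k t)).1) /\
    smooth_family (fun k t => (rotation (a k t) (z1 k t, z2 k t)).2).
  move=> s1 s2 sa; split.
    exact: (smoothB (smoothM s1 (smooth_cos sa)) (smoothM s2 (smooth_sin sa))).
  exact: (smoothD (smoothM s1 (smooth_sin sa)) (smoothM s2 (smooth_cos sa))).
have [sr1 sr2] := srotation _ _ _ sv01 sv02 sDk.
have sq1 : smooth_family q1 by exact: (smoothD (smoothM sm1 sv1) (smoothM smu sr1)).
have sq2 : smooth_family q2 by exact: (smoothD (smoothM sm1 sv2) (smoothM smu sr2)).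
(* v being a positive multiple of v0 turned by Dk, so is the convex combination
   (q1, q2), which is therefore nonzero. *)
pose p1 k t := (rotation (- (mu k * Dk k t)) (q1 k t, q2 k t)).1.
pose p2 k t := (rotation (- (mu k * Dk k t)) (q1 k t, q2 k t)).2.
have [sp1 sp2] : smooth_family p1 /\ smooth_family p2.
  exact: (srotation _ _ _ sq1 sq2 (smoothN (smoothM smu sDk))).
pose e1 k t := (1 - mu k) * E1 (sg k) t.
pose e2 k t := (1 - mu k) * E2 (sg k) t.
have se1 : smooth_family e1 by exact: (smoothM sm1 (smooth_comp csg sE1)).
have se2 : smooth_family e2 by exact: (smoothM sm1 (smooth_comp csg sE2)).
have pq k t : q1 k (t + pi *+ 2) = q1 k t /\ q2 k (t + pi *+ 2) = q2 k t.
  by rewrite /q1 /q2 /v /v0 /Dk !curve_vel_periodic pD.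
have pp1 k t : p1 k (t + pi *+ 2) = p1 k t.
  by rewrite /p1 /Dk pD; have [-> ->] := pq k t.
have pp2 k t : p2 k (t + pi *+ 2) = p2 k t.
  by rewrite /p2 /Dk pD; have [-> ->] := pq k t.
have pe1 k t : e1 k (t + pi *+ 2) = e1 k t by rewrite /e1 pE1.
have pe2 k t : e2 k (t + pi *+ 2) = e2 k t by rewrite /e2 pE2.
have v0pos k t : 0 < dot (v0 k t) (v0 k t) by rewrite -plane_neq0 curve_vel_neq0.
have mub k : 0 <= mu k <= 1 by rewrite cut_ge0 cut_le1.
have pE k t : (p1 k t, p2 k t) = rotation (- (mu k * Dk k t)) (q1 k t, q2 k t).
  by rewrite /p1 /p2 -surjective_pairing.
have ppos k t : 0 < dot (p1 k t, p2 k t) (p1 k t, p2 k t).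
  rewrite pE dot_rotation; have [r r0 vr] := dD (sg k) t.
  have -> : dot (q1 k t, q2 k t) (q1 k t, q2 k t) =
      ((1 - mu k) * r + mu k) ^+ 2 * dot (v0 k t) (v0 k t).
    rewrite -[in RHS](dot_rotation (Dk k t)) /q1 /q2 /v vr /dot -/(v0 k t) -/(Dk k t) /=.
    by ring.
  rewrite mulr_gt0// exprn_gt0//; have /andP[m0 m1] := mub k.
  have [m1'|m1'] := ltP (mu k) 1; last by rewrite ltr_wpDl ?mulr_ge0 ?(ltW r0)//; lra.
  by rewrite ltr_pwDl// mulr_gt0//; lra.
have de1 k t : derive1 (e1 k) t = (1 - mu k) * derive1 (E1 (sg k)) t.
  apply: derive1_unique.
  apply: (is_derive_eq (is_deriveM (is_derive_cst (1 - mu k) t 1)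
    (smooth_is_derive (sg k) t sE1))).
  by rewrite scaler0 addr0.
have de2 k t : derive1 (e2 k) t = (1 - mu k) * derive1 (E2 (sg k)) t.
  apply: derive1_unique.
  apply: (is_derive_eq (is_deriveM (is_derive_cst (1 - mu k) t 1)
    (smooth_is_derive (sg k) t sE2))).
  by rewrite scaler0 addr0.
have vE k t : v k t = v0 k t + (derive1 (E1 (sg k)) t, derive1 (E2 (sg k)) t).
  exact: velE.
have alt0 k t : mu k = 0 ->
    v0 k t + (derive1 (e1 k) t, derive1 (e2 k) t) = (p1 k t, p2 k t).
  move=> m0; rewrite pE de1 de2 m0 subr0 !mul1r mul0r oppr0 rotation0 -vE.
  by rewrite /q1 /q2 m0 !mul0r subr0 !mul1r !addr0 [LHS]surjective_pairing.
have alt1 k t : mu k = 1 ->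
    v0 k t + (derive1 (e1 k) t, derive1 (e2 k) t) = (p1 k t, p2 k t).
  move=> m1; rewrite pE de1 de2 m1 !subrr !mul0r addr0.
  rewrite /q1 /q2 m1 !subrr !mul0r !mul1r !add0r -surjective_pairing.
  have := rotationD (Dk k t) (- Dk k t) (v0 k t); rewrite addrN rotation0; exact.
(* On the stationary thirds the amplitude may be below 1 while [mu] moves. There D and the
   derivatives of [E1], [E2] vanish, so v = v0 and the field equals the velocity for every [mu]. *)
have altD k t : sg k = zero \/ sg k = one ->
    v0 k t + (derive1 (e1 k) t, derive1 (e2 k) t) = (p1 k t, p2 k t).
  move=> sgk; have [D0 [E10 E20]] : Dk k t = 0 /\
      (derive1 (E1 (sg k)) t = 0 /\ derive1 (E2 (sg k)) t = 0).
    have cstE (E : R -> R) : (forall u, E u = 0) -> derive1 E t = 0.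
      move=> E0; have -> : E = cst 0 by apply/funext.
      exact: derive1_cst.
    rewrite /Dk; case: sgk => ->; split; do ?split; do ?apply: cstE => u.
    - by have [] := bD t.
    - by have [] := bE1 u.
    - by have [] := bE2 u.
    - by have [_ ->] := bD t; rewrite mulr0.
    - by have [_ ->] := bE1 u; rewrite mulr0.
    - by have [_ ->] := bE2 u; rewrite mulr0.
  rewrite pE de1 de2 E10 E20 D0 !mulr0 oppr0 rotation0 addr0.
  have vk : v k t = v0 k t.
    have := vE k t.
    rewrite E10 E20.
    rewrite addr0.
    exact.
  rewrite /q1 /q2 D0 rotation0 vk -!mulrDl subrK !mul1r; exact: surjective_pairing.
have alt k t : kap k = 1 \/
    curve_vel xi t + (derive1 (e1 k) t, derive1 (e2 k) t) = (p1 k t, p2 k t).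
  have [ts|ms|ms] := tent_middle k.2; [|by right; apply: altD; left|by right; apply: altD; right].
  have [h1|h1] := leP (3 * itv_val k.1) 1.
    by right; apply: alt0; rewrite /mu cut_eq0// subr_le0.
  have [h2|h2] := leP 2 (3 * itv_val k.1).
    by right; apply: alt1; rewrite /mu cut_eq1//; lra.
  left; rewrite /kap ts mul1r cut_eq1; last by lra.
  by rewrite cut_eq0 ?subr0//; lra.
have cII : compact [set: I * I].
  by rewrite -setXTT; exact: compact_setX (@compact_itv_setT R) (@compact_itv_setT R).
have [g [f1 [f2 [M [cg _ gE g0 _]]]]] := wiggle_family cII (@ltr01 R)
  se1 se2 sp1 sp2 pe1 pe2 pp1 pp2 ppos ckap kapb alt.
have g_end k : kap k = 0 -> (forall t, e1 k t = 0) -> (forall t, e2 k t = 0) -> g k = xi.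
  move=> k0 h1 h2; apply: angular_inj => t; rewrite gE.
  have [-> ->] := g0 k k0 t; rewrite h1 h2.
  by apply: (@twisted_int xi 0 0 0 0); rewrite mulr0.
have [q qE] : exists q : loop, forall s, q s = p (middle s).
  apply: path_loop; first exact: (continuousT_comp middle_continuous (@cts_fun _ _ p)).
    by rewrite middle_zero path_zero.
  by rewrite middle_one path_one.
apply: homotopic_trans (middle_homotopic qE) _; exists g; split => //.
- move=> s; rewrite qE; apply: angular_inj => t; rewrite gE angE.
  have kz : kap (zero, s) = 0.
    by rewrite /kap /= itv_val_zero mulr0 !cut_eq0 ?subrr ?mulr0//; lra.
  have [-> ->] := g0 _ kz t.
  rewrite /e1 /e2 /mu /= itv_val_zero mulr0 cut_eq0; last by lra.
  by rewrite subr0 !mul1r.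
- move=> s; apply: g_end.
  + by rewrite /kap /= itv_val_one mulr1 !cut_eq1 ?subrr ?mulr0//; lra.
  + by move=> t; rewrite /e1 /mu /= itv_val_one mulr1 cut_eq1 ?subrr ?mul0r//; lra.
  + by move=> t; rewrite /e2 /mu /= itv_val_one mulr1 cut_eq1 ?subrr ?mul0r//; lra.
- move=> s; apply: g_end.
  + by rewrite /kap /= tent_zero mul0r.
  + by move=> t; rewrite /e1 /sg /= middle_zero; have [-> _] := bE1 t; rewrite mulr0.
  + by move=> t; rewrite /e2 /sg /= middle_zero; have [-> _] := bE2 t; rewrite mulr0.
- move=> s; apply: g_end.
  + by rewrite /kap /= tent_one mul0r.
  + by move=> t; rewrite /e1 /sg /= middle_one; have [_ ->] := bE1 t; rewrite !mulr0.
  + by move=> t; rewrite /e2 /sg /= middle_one; have [_ ->] := bE2 t; rewrite !mulr0.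
Qed.

End main_lemmas.

(** * The isomorphism *)

Section winding_loops.
Context {R : realType} {X : topologicalType} (x : X) (zeta : X -> R * R).
Context (zeta_cont : continuous zeta) (zeta_neq0 : forall y, zeta y != 0).
Local Notation I := (unit_itv R).
Local Notation loop := {path I from x to x in X}.

Lemma loop_wind_exists (p : loop) : exists k, wind (fun s => zeta (p s)) k.
Proof.
apply: wind_exists => [||]; last by rewrite path_one path_zero.
  exact: (continuousT_comp (@cts_fun _ _ p) zeta_cont).
by move=> s; exact: zeta_neq0.
Qed.

Lemma loop_wind_unique (p : loop) k k' : wind (fun s => zeta (p s)) k ->
  wind (fun s => zeta (p s)) k' -> k = k'.
Proof. by apply: wind_unique; exact: zeta_neq0. Qed.

Lemma loop_wind_homotopic (p q : loop) k : homotopic p q ->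
  wind (fun s => zeta (p s)) k -> wind (fun s => zeta (q s)) k.
Proof.
move=> [H [cH H0 H1 Hz Ho]].
have -> : (fun s => zeta (p s)) = (fun t => zeta (H (zero, t))).
  by apply/funext => s; rewrite H0.
have -> : (fun s => zeta (q s)) = (fun t => zeta (H (one, t))).
  by apply/funext => s; rewrite H1.
apply: (@wind_homotopy R (fun u => zeta (H u))).
- exact: continuousT_comp cH zeta_cont.
- by move=> u; exact: zeta_neq0.
- by move=> s; rewrite Hz Ho.
Qed.

Lemma loop_wind_concat (p q : loop) k k' :
  wind (fun s => zeta (p s)) k -> wind (fun s => zeta (q s)) k' ->
  wind (fun s => zeta (loop_concat p q s)) (k + k').
Proof.
move=> wp wq; apply: (wind_concat wp wq); first by rewrite path_one path_zero.
by move=> a; rewrite [X in zeta X = _]concat_funE; case: ifP.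
Qed.

Definition loop_degree (p : loop) : int := projT1 (cid (loop_wind_exists p)).

Lemma loop_degreeP (p : loop) : wind (fun s => zeta (p s)) (loop_degree p).
Proof. by rewrite /loop_degree; case: cid. Qed.

(** The homomorphism to Z induced on fundamental groups by a map [zeta] into the punctured plane. *)
Definition pi1_degree (a : fundamental_group R x) : int := loop_degree (repr a).

Lemma pi1_degreeP (p : loop) k :
  wind (fun s => zeta (p s)) k <-> pi1_degree (loop_class p) = k.
Proof.
have h : wind (fun s => zeta (p s)) (pi1_degree (loop_class p)).
  exact: loop_wind_homotopic (repr_loop_class p) (loop_degreeP _).
by split => [w|<-//]; exact: loop_wind_unique h w.
Qed.

Lemma pi1_degreeM (a b : fundamental_group R x) :
  pi1_degree (pi1_mul a b) = pi1_degree a + pi1_degree b.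
Proof.
by apply/pi1_degreeP/loop_wind_concat; exact: loop_degreeP.
Qed.

End winding_loops.

Section torus_pi1.
Context {R : realType} (xi : torus_curve R).
Local Notation I := (unit_itv R).
Local Notation loop := {path I from xi to xi in torus_curve R}.

(** Joint continuity of the derivatives, applied to the tautological family of all curves and
    restricted to t = 0. *)
Lemma angular0_continuous n :
  continuous (fun f : torus_curve R => derive1n n (angular (sval f)) 0).
Proof.
have id_cont : continuous (fun f : torus_curve R => f) by move=> ?; exact: cvg_id.
have c0 : continuous (fun f : torus_curve R => (f, 0 : R)).
  exact: continuousT_pair id_cont (@cst_continuous _ _ _).
exact: (continuousT_comp c0 (continuous_derivatives id_cont (n := n))).
Qed.

Lemma base1_continuous : continuous (@base1 R).
Proof. exact: (continuousT_comp (@angular0_continuous 0) (@continuous_fst _ _)). Qed.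

Lemma base2_continuous : continuous (@base2 R).
Proof. exact: (continuousT_comp (@angular0_continuous 0) (@continuous_snd _ _)). Qed.

Lemma base_vel_continuous : continuous (@base_vel R).
Proof.
have c1 := @angular0_continuous 1.
apply: continuousT_pair.
  apply: (cross_continuous base1_continuous).
  exact: (continuousT_comp c1 (@continuous_fst _ _)).
apply: (cross_continuous base2_continuous).
exact: (continuousT_comp c1 (@continuous_snd _ _)).
Qed.

(** The first two integers count the turns of the base point in the circle factors, the third those
    of the velocity there; Z^3 is written multiplicatively to match the group law on loops. *)
Definition pi1_degrees (a : fundamental_group R xi) :
    Algebra.to_multiplicative (int * int * int)%type :=
  (pi1_degree base1_continuous base1_neq0 a, pi1_degree base2_continuous base2_neq0 a,
   pi1_degree base_vel_continuous base_vel_neq0 a).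

Lemma pi1_degreesM : {morph pi1_degrees : a b / (a * b)%g}.
Proof.
move=> a b; rewrite /pi1_degrees [(a * b)%g]/(pi1_mul a b).
by rewrite !pi1_degreeM.
Qed.

HB.instance Definition _ := isMultiplicative.Build _ _ pi1_degrees pi1_degreesM.

Lemma pi1_degrees_inj : injective pi1_degrees.
Proof.
move=> a b ab.
have h : pi1_degrees (pi1_mul a (pi1_inv b)) = (0, 0, 0).
  have : pi1_degrees (pi1_mul (pi1_mul a (pi1_inv b)) b) = pi1_degrees b.
    by rewrite -pi1_mulA pi1_mulVg pi1_mulg1.
  rewrite /pi1_degrees (pi1_degreeM base1_continuous base1_neq0).
  rewrite (pi1_degreeM base2_continuous base2_neq0).
  rewrite (pi1_degreeM base_vel_continuous base_vel_neq0) => -[h1 h2 h3].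
  by congr (_, _, _); lia.
have : pi1_mul a (pi1_inv b) = pi1_one R xi.
  move: h; rewrite -[pi1_mul _ _]loop_classK => -[h1 h2 h3].
  apply/loop_classP/homotopic_constant.
  - exact/(pi1_degreeP base1_continuous base1_neq0).
  - exact/(pi1_degreeP base2_continuous base2_neq0).
  - exact/(pi1_degreeP base_vel_continuous base_vel_neq0).
move=> /(congr1 (fun c => pi1_mul c b)).
by rewrite -pi1_mulA pi1_mulVg pi1_mulg1 pi1_mul1g.
Qed.

Lemma pi1_degrees_surj d : exists a, pi1_degrees a = d.
Proof.
case: d => -[m n] k; have [p [p1 p2 p3]] := loop_with_degrees xi m n k.
exists (loop_class p); rewrite /pi1_degrees.
by congr (_, _, _); apply/pi1_degreeP.
Qed.

End torus_pi1.

Theorem theorem2p2p2 (R : realType) (xi : torus_curve R) :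
  group_isomorphic (fundamental_group R xi)
    (Algebra.to_multiplicative (int * int * int)%type).
Proof.
exists (@pi1_degrees R xi).
have /choice[h hE] := @pi1_degrees_surj R xi.
by exists h => [a|//]; apply: pi1_degrees_inj; rewrite hE.
Qed.
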